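(* Let $k$ be a positive integer, $\alpha_0,\alpha_1,\dots,\alpha_{k-1}\in\omega_1$ and $m_0,m_1,\dots,m_{k-1}\in\omega\setminus\{0\}$. Then \[P^{top}(\overline\omega[\alpha_0,m_0],\overline\omega[\alpha_1,m_1],\dots,\overline\omega[\alpha_{k-1},m_{k-1}])=\overline\omega[\alpha,m],\] where $\alpha=\alpha_0\#\alpha_1\#\cdots\#\alpha_{k-1}$ and $m=\sum_{i=0}^{k-1}(m_i-1)+1$.
   Context: Ordinals carry the order topology, subsets the subspace topology; arithmetic is ordinal arithmetic. For an ordinal $\alpha$ and $m\in\omega\setminus\{0\}$, $\overline\omega[\alpha,m]=\omega^\alpha\cdot m+1$ if $\alpha>0$ and $\overline\omega[\alpha,m]=m$ if $\alpha=0$. $P^{top}(\beta_0,\dots,\beta_{k-1})$ is the least ordinal $\beta$ such that for every $c:\beta\to\{0,\dots,k-1\}$ there exist $i$ and $X\subseteq c^{-1}(\{i\})$ homeomorphic to $\beta_i$. The natural sum $\alpha\#\beta$: write $\alpha=\sum_j\omega^{\gamma_j}l_j$, $\beta=\sum_j\omega^{\gamma_j}m_j$ with common decreasing exponents and $l_j,m_j\in\omega$; then $\alpha\#\beta=\sum_j\omega^{\gamma_j}(l_j+m_j)$. *)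

(* Defs.v *)
From HB Require Import structures.
From mathcomp Require Import all_boot all_order.
From mathcomp Require Import all_classical topology.

Set Implicit Arguments.
Unset Strict Implicit.
Unset Printing Implicit Defensive.

Import Order.TTheory.
Local Open Scope classical_set_scope.
Local Open Scope order_scope.
Local Open Scope quotient_scope.

(* [Pre A f] stands for the least ordinal strictly above all the [f a];
   [Ord] is the quotient of [pre] by the induced equality of ordinals,
   so it realizes the class of all (small) ordinals. *)

Inductive pre : Type := Pre (A : Type) (f : A -> pre).

Fixpoint ple (x y : pre) {struct x} : Prop :=
  let: Pre A f := x in
  let: Pre B g := y in forall a : A, exists b : B, ple (f a) (g b).

Definition pidx (x : pre) : Type := let: Pre A _ := x in A.
Definition pelt (x : pre) : pidx x -> pre := let: Pre _ f := x in f.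

Lemma ple_refl x : ple x x.
Proof. by elim: x => A f IH a; exists a; exact: IH. Qed.

Lemma ple_trans y x z : ple x y -> ple y z -> ple x z.
Proof.
elim: x y z => A f IH [B g] [C h] xy yz a.
by have [b fg] := xy a; have [c gh] := yz b; exists c; exact: IH fg gh.
Qed.

Lemma ple_elt x (a : pidx x) : ple (pelt a) x.
Proof.
elim: x a => A f IH /= a; move: (IH a).
by case E: (f a) => [C h] hC c; exists a; rewrite E; exact: hC.
Qed.

Lemma pelt_nge x (a : pidx x) : ~ ple x (pelt a).
Proof.
elim: x a => A f IH /= a; move: (IH a).
case E: (f a) => [C h] hC H; have [c] := H a.
by rewrite E; exact: hC.
Qed.

Lemma pltP x y : ~ ple y x <-> exists b : pidx y, ple x (pelt b).
Proof.
split; last by move=> [b xb] yx; exact/(@pelt_nge y b)/(ple_trans yx).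
elim: x y => A f IH [B g] /= /existsNP[b /forallNP Hb].
exists b; case E: (g b) => [C h] /= a.
by move: (Hb a); rewrite E => /IH.
Qed.

Lemma ple_total x y : ple x y \/ ple y x.
Proof.
have [|/pltP[b yb]] := pselect (ple x y); [by left|right].
exact: ple_trans yb (ple_elt b).
Qed.

HB.instance Definition _ := gen_eqMixin pre.
HB.instance Definition _ := gen_choiceMixin pre.

Definition peq (x y : pre) : bool := `[< ple x y >] && `[< ple y x >].

Lemma peq_refl : reflexive peq.
Proof. by move=> x; apply/andP; split; apply/asboolP/ple_refl. Qed.

Lemma peq_sym : symmetric peq.
Proof. by move=> x y; rewrite /peq andbC. Qed.

Lemma peq_trans : transitive peq.
Proof.
move=> y x z /andP[/asboolP xy /asboolP yx] /andP[/asboolP yz /asboolP zy].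
apply/andP; split; apply/asboolP; first exact: ple_trans xy yz.
exact: ple_trans zy yx.
Qed.

Canonical peq_equiv := EquivRel peq peq_refl peq_sym peq_trans.

Definition Ord : Type := {eq_quot peq}.
HB.instance Definition _ := Choice.on Ord.
HB.instance Definition _ := EqQuotient.on Ord.

Definition ole (x y : Ord) : bool := `[< ple (repr x) (repr y) >].
Definition olt (x y : Ord) : bool := (y != x) && ole x y.

Lemma ole_refl : reflexive ole.
Proof. by move=> x; apply/asboolP/ple_refl. Qed.

Lemma ole_anti : antisymmetric ole.
Proof.
move=> x y xy; rewrite -[x]reprK -[y]reprK; apply/eqmodP; exact: xy.
Qed.

Lemma ole_trans : transitive ole.
Proof.
by move=> y x z /asboolP xy /asboolP yz; apply/asboolP/(ple_trans xy).
Qed.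

Lemma ole_total : total ole.
Proof.
move=> x y; have [xy|yx] := ple_total (repr x) (repr y); apply/orP.
  by left; apply/asboolP.
by right; apply/asboolP.
Qed.

Fact ord_display : Order.disp_t. Proof. exact: Order.Disp tt tt. Qed.

HB.instance Definition _ := Order.isPOrder.Build ord_display Ord
  (fun _ _ => erefl) ole_refl ole_anti ole_trans.
HB.instance Definition _ := Order.POrder_isTotal.Build ord_display Ord ole_total.

Lemma ole_pi (x y : pre) : (\pi_Ord x <= \pi_Ord y) = `[< ple x y >] :> bool.
Proof.
have H z : ple z (repr (\pi_Ord z)) /\ ple (repr (\pi_Ord z)) z.
  have /eqmodP/andP[/asboolP ? /asboolP ?] : z = repr (\pi_Ord z) %[mod Ord].
    by rewrite reprK.
  by [].
have [[x1 x2] [y1 y2]] := (H x, H y).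
apply: asbool_equiv_eq; split => xy; last exact: ple_trans x2 (ple_trans xy y1).
exact: ple_trans x1 (ple_trans xy y2).
Qed.

Lemma olt_wf : well_founded (fun x y : Ord => x < y : Prop).
Proof.
suff H p z : ple (repr z) p -> Acc (fun x y : Ord => x < y : Prop) z.
  by move=> x; exact: H (ple_refl _).
elim: p z => A f IH z; case E: (repr z) => [C h] zp.
constructor => w; rewrite ltNge => /asboolPn/pltP; rewrite E => -[c wc].
by have [a fa] := zp c; apply: (IH a); exact: ple_trans wc fa.
Qed.

Lemma ord_sup (A : Type) (h : A -> Ord) : exists z, forall a, h a < z.
Proof.
exists (\pi_Ord (Pre (fun a => repr (h a)))) => a.
rewrite -{1}[h a]reprK ltNge ole_pi; apply/asboolPn.
exact: (@pelt_nge (Pre (fun a => repr (h a))) a).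
Qed.

Fixpoint pclosure (x : pre) : pre :=
  let: Pre A f := x in
  @Pre {a : A & option (pidx (pclosure (f a)))}
    (fun p => if projT2 p is Some c then pelt c else f (projT1 p)).

(* The initial segments of [Ord] are small enough to index a supremum. *)
Lemma ord_small (y : Ord) :
  exists (A : Type) (h : A -> Ord), forall x, x < y -> exists a, h a = x.
Proof.
exists (pidx (pclosure (repr y))), (fun b => \pi_Ord (pelt b)) => x.
rewrite ltNge => /asboolPn; elim: (repr y) => A f IH /pltP /= [a xa].
have [ax|/IH[c cx]] := pselect (ple (f a) (repr x)); last first.
  by exists (existT _ a (Some c)).
exists (existT _ a None) => /=; rewrite -[RHS]reprK; apply/eqmodP.
by apply/andP; split; apply/asboolP.
Qed.

Lemma ord_replacement (h : Ord -> Ord) (y : Ord) :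
  exists z, forall x, x < y -> h x < z.
Proof.
have [A [g gP]] := ord_small y; have [z zP] := ord_sup (h \o g).
by exists z => x /gP[a <-]; exact: zP.
Qed.

Definition is_least (P : set Ord) (x : Ord) : Prop :=
  P x /\ forall y, P y -> x <= y.

Definition ozero : Ord := \pi_Ord (@Pre False (fun p => False_rect pre p)).

Lemma ozero_le x : ozero <= x.
Proof. by rewrite -[x]reprK ole_pi; case: (repr x) => B g; apply/asboolP. Qed.

(* Only used on nonempty [P] (see [oleastP]). *)
Definition oleast (P : set Ord) : Ord := xget ozero (is_least P).

Lemma oleastP (P : set Ord) : P !=set0 -> is_least P (oleast P).
Proof.
move=> [x]; elim/(well_founded_ind olt_wf): x => x IH Px.
have [[y [yx Py]]|H] := pselect (exists y, y < x /\ P y); first exact: IH Py.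
apply: (@xgetI _ ozero _ x); split=> // y Py.
by rewrite leNgt; apply/negP => yx; apply: H; exists y.
Qed.

Definition osucc (x : Ord) : Ord := oleast [set z | x < z].

Definition onat (n : nat) : Ord := iter n osucc ozero.

Definition omega : Ord := oleast [set z | forall n, onat n < z].

(* [oadd x y] is the supremum of [x] and of the [oadd x y' + 1], [y' < y]. *)
Definition oadd (x : Ord) : Ord -> Ord :=
  Fix olt_wf (fun=> Ord) (fun y rec =>
    oleast [set z | x <= z /\ forall y' (h : y' < y), rec y' h < z]).

(* [omul x y] is the supremum of the [oadd (omul x y') x], [y' < y]. *)
Definition omul (x : Ord) : Ord -> Ord :=
  Fix olt_wf (fun=> Ord) (fun y rec =>
    oleast [set z | forall y' (h : y' < y), oadd (rec y' h) x <= z]).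

(* [omega_pow y] is the supremum of [1] and of the
   [omul (omega_pow y') omega], [y' < y]. *)
Definition omega_pow : Ord -> Ord :=
  Fix olt_wf (fun=> Ord) (fun y rec =>
    oleast [set z | onat 1 <= z /\
                    forall y' (h : y' < y), omul (rec y' h) omega <= z]).

Lemma oFixE (F : forall y : Ord, (forall y', y' < y -> Ord) -> Ord) y :
  Fix olt_wf (fun=> Ord) F y = F y (fun y' _ => Fix olt_wf (fun=> Ord) F y').
Proof.
apply: (Fix_eq olt_wf (fun=> Ord)) => x f g fg; congr (F x).
by apply: functional_extensionality_dep => y'; apply/funext => h; exact: fg.
Qed.

Lemma osucc_least x : is_least [set z | x < z] (osucc x).
Proof.
by apply: oleastP; have [z zP] := ord_sup (fun _ : unit => x); exists z; exact: zP tt.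
Qed.

Lemma omega_least : is_least [set z | forall n, onat n < z] omega.
Proof. by apply: oleastP; have [z zP] := ord_sup onat; exists z. Qed.

Lemma oadd_least x y :
  is_least [set z | x <= z /\ forall y', y' < y -> oadd x y' < z] (oadd x y).
Proof.
rewrite {2}/oadd oFixE; apply: oleastP.
have [z zP] := ord_replacement (oadd x) y.
exists (Order.max x z); split; first by rewrite le_max lexx.
by move=> y' /zP y'z; rewrite lt_max y'z orbT.
Qed.

Lemma omul_least x y :
  is_least [set z | forall y', y' < y -> oadd (omul x y') x <= z] (omul x y).
Proof.
rewrite {2}/omul oFixE; apply: oleastP.
have [z zP] := ord_replacement (fun y' => oadd (omul x y') x) y.
by exists z => y' /zP/ltW.
Qed.

Lemma omega_pow_least y :
  is_least [set z | onat 1 <= z /\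
                    forall y', y' < y -> omul (omega_pow y') omega <= z]
           (omega_pow y).
Proof.
rewrite {2}/omega_pow oFixE; apply: oleastP.
have [z zP] := ord_replacement (fun y' => omul (omega_pow y') omega) y.
exists (Order.max (onat 1) z); split; first by rewrite le_max lexx.
by move=> y' /zP/ltW y'z; rewrite le_max y'z orbT.
Qed.

(* [cnf [:: (g1, l1); (g2, l2); ...]] is
   [omega^g1 * l1 + omega^g2 * l2 + ...]. *)
Definition cnf (s : seq (Ord * nat)) : Ord :=
  foldr (fun t x => oadd (omul (omega_pow t.1) (onat t.2)) x) ozero s.

Definition is_natsum (x y z : Ord) : Prop :=
  exists s : seq (Ord * (nat * nat)),
    [/\ sorted >%O [seq t.1 | t <- s],
        x = cnf [seq (t.1, t.2.1) | t <- s],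
        y = cnf [seq (t.1, t.2.2) | t <- s] &
        z = cnf [seq (t.1, (t.2.1 + t.2.2)%N) | t <- s]].

(* Coefficients may be 0 in [is_natsum], so that the exponents can be shared;
   by the Cantor normal form theorem exactly one [z] qualifies. *)
Definition natsum (x y : Ord) : Ord := xget ozero (is_natsum x y).

Definition omega1 : Ord := oleast [set x | ~ countable [set y | y < x]].

(* The values of [pbrouwer] are cofinal in [omega1]; this only serves to show
   that an uncountable ordinal exists. *)
Inductive brouwer : Type := BZero | BLim (s : nat -> brouwer).

Fixpoint pbrouwer (t : brouwer) : pre :=
  if t is BLim s then Pre (fun n => pbrouwer (s n))
  else @Pre False (fun p => False_rect pre p).

Lemma omega1_least :
  is_least [set x | ~ countable [set y | y < x]] omega1.
Proof.
apply: oleastP; exists (\pi_Ord (Pre pbrouwer)) => /= /countable_injP[g ginj].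
set z := \pi_Ord _ in ginj.
have ltz x : x < z -> exists t, x <= \pi_Ord (pbrouwer t).
  rewrite -[x]reprK ltNge ole_pi => /asboolPn/pltP[t xt]; exists t.
  by rewrite ole_pi; apply/asboolP.
have [s sP] : exists s : nat -> brouwer, forall n x, x < z -> g x = n ->
    x <= \pi_Ord (pbrouwer (s n)).
  suff /choice[s sP] : forall n, exists t, forall x, x < z -> g x = n ->
    x <= \pi_Ord (pbrouwer t) by exists s.
  move=> n; have [[x [xz gx]]|H] := pselect (exists x, x < z /\ g x = n).
    have [t xt] := ltz _ xz; exists t => y yz gy.
    have -> // : y = x by apply: ginj; rewrite ?inE //= gy gx.
  by exists BZero => x xz gx; exfalso; apply: H; exists x.
pose w := \pi_Ord (pbrouwer (BLim s)).
have wz : w < z.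
  rewrite ltNge ole_pi; apply/asboolPn.
  exact: (@pelt_nge (Pre pbrouwer) (BLim s)).
have := sP _ _ wz erefl; rewrite ole_pi => /asboolP.
exact: (@pelt_nge (pbrouwer (BLim s)) (g w)).
Qed.

Lemma lt_omega1 x : x < omega1 <-> countable [set y | y < x].
Proof.
have [unc least] := omega1_least; split=> [xw|cx].
  by apply: contrapT => /least; rewrite leNgt xw.
rewrite ltNge; apply/negP => wx; apply: unc; apply: sub_countable cx.
by apply: subset_card_le => y /= yw; exact: lt_le_trans yw wx.
Qed.

Definition segment (b : Ord) : Type := {x : Ord | x < b}.

HB.instance Definition _ (b : Ord) := SubType.on (segment b).
HB.instance Definition _ (b : Ord) := [Choice of segment b by <:].
HB.instance Definition _ (b : Ord) :=
  [SubChoice_isSubOrder of segment b by <: with ord_display].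
HB.instance Definition _ (b : Ord) :=
  OrderTopological.copy (segment b) (order_topology (segment b)).

Definition homeomorphic (S T : topologicalType) : Prop :=
  exists (f : S -> T) (g : T -> S),
    [/\ continuous f, continuous g, cancel f g & cancel g f].

(* A subset [X], as a type, carries the subspace topology. *)
Definition top_arrow (k : nat) (b : 'I_k -> Ord) (beta : Ord) : Prop :=
  forall c : segment beta -> 'I_k,
    exists (i : 'I_k) (X : set (segment beta)),
      X `<=` c @^-1` [set i] /\ homeomorphic (set_type X) (segment (b i)).

(* [beta = P^top(b_0, ..., b_(k-1))]; this includes the existence of
   [P^top(b_0, ..., b_(k-1))]. *)
Definition is_Ptop (k : nat) (b : 'I_k -> Ord) (beta : Ord) : Prop :=
  is_least (top_arrow b) beta.

Definition omega_bar (a : Ord) (m : nat) : Ord :=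
  if a == ozero then onat m else oadd (omul (omega_pow a) (onat m)) (onat 1).

(* Main.v *)
Require Import Defs.
From mathcomp Require Import all_boot all_order.
From mathcomp Require Import all_classical topology interval.

(* Replace a point [x] by [1 + x]: then [omega_bar a m] becomes the interval
   [(0, omega^a * m]], uniformly in [a] and without a special case for [0].

   Upper bound.  Let [X_i] be the colour classes and let [rank] be the
   Cantor-Bendixson rank.  If [p] has rank at least [a_0 # ... # a_(k-1)], then
   arbitrarily close below [p], or at [p] itself, some [X_i] has a point of rank
   at least [a_i] in [X_i]: if [p] is in [X_j] but has rank less than [a_j] in
   [X_j], some [b < a_j] bounds the ranks in [X_j] near [p], so replace [a_j] by
   [b], which decreases the natural sum, and descend to a point of that smaller
   rank.  Applied to the points [omega^a * (j + 1)], [j < m], this gives, by the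
   pigeonhole principle, [m_i] points of rank at least [a_i] in one [X_i].  Such
   a point is the limit of a closed copy of [omega^(a_i) + 1] inside [X_i]
   (induction on [a_i], using countability to choose cofinal sequences), and
   [m_i] such copies are concatenated.

   Lower bound.  The ordinal [a_0 # ... # a_(k-1)] splits into [k] pieces of
   order types [a_i].  Colour a point by the piece that contains its rank, and
   distribute the fewer than [m] points of maximal rank so that colour [i] gets
   at most [m_i - 1] of them.  A topological copy of [omega_bar a_i m_i] of
   colour [i] would contain [m_i] points whose rank has position at least [a_i]
   in piece [i], that is, [m_i] points of maximal rank. *)

Set Implicit Arguments.
Unset Strict Implicit.
Unset Printing Implicit Defensive.

Import Order.TTheory.
Local Open Scope classical_set_scope.
Local Open Scope order_scope.

Local Notation "x +o y" := (oadd x y) (at level 50, left associativity).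
Local Notation "x *o n" := (omul x (onat n)) (at level 40, left associativity).

(** * Ordinal arithmetic *)

Lemma ord_ind (P : Ord -> Prop) :
  (forall x, (forall y, y < x -> P y) -> P x) -> forall x, P x.
Proof. exact: (well_founded_ind olt_wf). Qed.

Lemma le_of_lt (x y : Ord) : (forall z, z < x -> z < y) -> x <= y.
Proof. by move=> H; rewrite leNgt; apply/negP => /H; rewrite ltxx. Qed.

Lemma ord_ltx0 x : (x < ozero) = false.
Proof. by rewrite ltNge ozero_le. Qed.

Lemma ord_lex0 x : (x <= ozero) = (x == ozero).
Proof. by rewrite eq_le ozero_le andbT. Qed.

Lemma ord_lt0x x : (ozero < x) = (x != ozero).
Proof. by rewrite lt_neqAle ozero_le andbT eq_sym. Qed.

Lemma osucc_le x y : (osucc x <= y) = (x < y).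
Proof.
have [H1 H2] := osucc_least x; apply/idP/idP; last exact: H2.
exact: lt_le_trans.
Qed.

Lemma lt_osucc x y : (x < osucc y) = (x <= y).
Proof. by rewrite ltNge osucc_le -leNgt. Qed.

Lemma osucc_gt x : x < osucc x. Proof. by rewrite lt_osucc. Qed.

Lemma osucc_lt2 x y : (osucc x < osucc y) = (x < y).
Proof. by rewrite lt_osucc osucc_le. Qed.

Lemma onat_mono (n p : nat) : (onat n < onat p) = (n < p)%N.
Proof.
elim: n p => [|n IH] [|p] /=; rewrite ?ltxx ?ord_ltx0 ?osucc_lt2 ?ltnS //.
by rewrite lt_osucc ozero_le.
Qed.

Lemma onat_le (n p : nat) : (onat n <= onat p) = (n <= p)%N.
Proof. by rewrite leNgt onat_mono -leqNgt. Qed.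

Lemma lt_onat x (n : nat) : x < onat n -> exists2 p, (p < n)%N & x = onat p.
Proof.
elim: n => [|n IH] /=; first by rewrite ord_ltx0.
rewrite lt_osucc le_eqVlt => /orP[/eqP ->|/IH[p pn ->]]; first by exists n.
by exists p => //; exact: ltnW.
Qed.

Lemma lt_omega x : x < omega -> exists n, x = onat n.
Proof.
move=> xw; apply: contrapT => H; have [_ L] := omega_least.
suff : omega <= x by rewrite leNgt xw.
apply: L => n /=.
rewrite ltNge; apply/negP; rewrite le_eqVlt => /orP[/eqP xn|/lt_onat[p _ xp]].
  by apply: H; exists n.
by apply: H; exists p.
Qed.

Lemma onat_omega n : onat n < omega.
Proof. by have [H _] := omega_least; exact: H. Qed.

Lemma oadd_lel x y : x <= x +o y.
Proof. by have [[]] := oadd_least x y. Qed.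

Lemma oadd_ltr_homo x y z : y < z -> x +o y < x +o z.
Proof. by have [[_ H] _] := oadd_least x z; exact: H. Qed.

Lemma oadd_lt2l x y z : (x +o y < x +o z) = (y < z).
Proof.
case: (ltgtP y z) => [yz|zy|->]; [exact: oadd_ltr_homo| | exact: ltxx].
by apply/negbTE; rewrite -leNgt; apply/ltW/oadd_ltr_homo.
Qed.

Lemma oadd_le2l x y z : (x +o y <= x +o z) = (y <= z).
Proof. by rewrite !leNgt oadd_lt2l. Qed.

Lemma oaddI x : injective (oadd x).
Proof. by move=> y z /eqP; rewrite eq_le !oadd_le2l -eq_le => /eqP. Qed.

Lemma oaddx0 x : x +o ozero = x.
Proof.
apply/eqP; rewrite eq_le oadd_lel andbT; have [_] := oadd_least x ozero; apply.
by split=> // y; rewrite ord_ltx0.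
Qed.

Lemma oadd_ler x y : y <= x +o y.
Proof.
elim/ord_ind: y => y IH; apply: le_of_lt => z zy.
by apply: le_lt_trans (IH _ zy) _; rewrite oadd_lt2l.
Qed.

(** By leastness of [x +o y]: a [z] missed by all [x +o y'] would, by induction, lie above each of
    them and so be an admissible bound. *)
Lemma lt_oadd_ex x y z : z < x +o y -> x <= z -> exists2 y', y' < y & z = x +o y'.
Proof.
elim/ord_ind: y z => y IH z zxy xz; apply: contrapT => H.
suff : x +o y <= z by rewrite leNgt zxy.
have [_] := oadd_least x y; apply; split=> // y' y'y.
rewrite lt_neqAle; apply/andP; split.
  by apply/eqP => E; apply: H; exists y'.
rewrite leNgt; apply/negP => /(IH _ y'y)/(_ xz)[w wy' E]; apply: H.
by exists w => //; exact: lt_trans y'y.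
Qed.

Lemma le_oadd_ex x z : x <= z -> exists y, z = x +o y.
Proof.
move=> xz; have : z < x +o osucc z by apply: lt_le_trans (oadd_ler _ _); exact: osucc_gt.
by move=> /lt_oadd_ex/(_ xz)[y _ ->]; exists y.
Qed.

Lemma oaddxS x y : x +o osucc y = osucc (x +o y).
Proof.
apply/eqP; rewrite eq_le osucc_le oadd_lt2l osucc_gt andbT.
have [_] := oadd_least x (osucc y); apply; split.
  by apply: le_trans (ltW (osucc_gt _)); exact: oadd_lel.
by move=> z; rewrite lt_osucc => zy; rewrite lt_osucc oadd_le2l.
Qed.

Lemma oadd0x x : ozero +o x = x.
Proof.
apply/eqP; rewrite eq_le oadd_ler andbT; elim/ord_ind: x => x IH.
have [_] := oadd_least ozero x; apply; split; first exact: ozero_le.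
by move=> y yx; apply: le_lt_trans (IH _ yx) _.
Qed.

Lemma oaddA x y z : x +o (y +o z) = x +o y +o z.
Proof.
elim/ord_ind: z => z IH; apply/eqP; rewrite eq_le; apply/andP; split.
  apply: le_of_lt => w wxyz.
  have [wx|xw] := ltP w x.
    by apply: lt_le_trans wx (le_trans (oadd_lel x y) (oadd_lel _ _)).
  have [v vyz ->] := lt_oadd_ex wxyz xw.
  have [vy|yv] := ltP v y.
    by apply: lt_le_trans (oadd_lel _ _); rewrite oadd_lt2l.
  by have [t tz ->] := lt_oadd_ex vyz yv; rewrite IH // oadd_lt2l.
apply: le_of_lt => w w1.
have [wx|xw] := ltP w (x +o y).
  by apply: lt_le_trans wx _; rewrite oadd_le2l oadd_lel.
by have [v vz ->] := lt_oadd_ex w1 xw; rewrite -IH // !oadd_lt2l.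
Qed.

Lemma oadd_le2r x y z : x <= y -> x +o z <= y +o z.
Proof.
move=> /le_oadd_ex[t ->]; rewrite -oaddA oadd_le2l; exact: oadd_ler.
Qed.

Lemma oadd_leD x y z t : x <= y -> z <= t -> x +o z <= y +o t.
Proof. by move=> xy zt; apply: le_trans (oadd_le2r _ xy) _; rewrite oadd_le2l. Qed.

Lemma oaddx1 x : x +o onat 1 = osucc x.
Proof. by rewrite /= oaddxS oaddx0. Qed.

Lemma onatD n p : onat n +o onat p = onat (n + p).
Proof.
by elim: p => [|p IH]; rewrite ?addnS /= ?oaddxS ?IH // oaddx0 addn0.
Qed.

Lemma oadd_gt x y : ozero < y -> x < x +o y.
Proof. by rewrite -{1}[x]oaddx0 oadd_lt2l. Qed.

(** * Multiples and powers of [omega] *)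

Lemma omulx0 x : x *o 0 = ozero.
Proof.
apply/eqP; rewrite -ord_lex0; have [_] := omul_least x ozero; apply.
by move=> y; rewrite ord_ltx0.
Qed.

Lemma omul_mono x y z : y <= z -> omul x y <= omul x z.
Proof.
move=> yz; have [_] := omul_least x y; apply => w wy.
by have [H _] := omul_least x z; apply: H; exact: lt_le_trans yz.
Qed.

Lemma omulxS x n : x *o n.+1 = x *o n +o x.
Proof.
apply/eqP; rewrite eq_le; apply/andP; split.
  have [_] := omul_least x (onat n.+1); apply=> y /lt_onat[p pn ->].
  by apply: oadd_le2r; apply: omul_mono; rewrite onat_le -ltnS.
by have [H _] := omul_least x (onat n.+1); apply: H; rewrite onat_mono.
Qed.

Lemma omulx1 x : x *o 1 = x.
Proof. by rewrite omulxS omulx0 oadd0x. Qed.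

Lemma omulxD x n p : x *o (n + p) = x *o n +o x *o p.
Proof.
by elim: p => [|p IH]; rewrite ?addnS ?omulxS ?IH ?oaddA // omulx0 oaddx0 addn0.
Qed.

Lemma lt_omul_omega x y : y < omul x omega -> exists n, y < x *o n.
Proof.
move=> yx; apply: contrapT => H; suff : omul x omega <= y by rewrite leNgt yx.
have [_] := omul_least x omega; apply=> z /lt_omega[n ->].
rewrite -omulxS leNgt; apply/negP => yn; by apply: H; exists n.+1.
Qed.

Lemma omul_onat n p : onat n *o p = onat (n * p).
Proof. by elim: p => [|p IH]; rewrite ?omulx0 ?muln0 // omulxS IH onatD mulnSr. Qed.

Lemma omega_pow_gt0 g : ozero < omega_pow g.
Proof.
have [[H _] _] := omega_pow_least g; apply: lt_le_trans H; exact: osucc_gt.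
Qed.

Lemma omega_pow0 : omega_pow ozero = onat 1.
Proof.
have [[H1 _] H2] := omega_pow_least ozero; apply/eqP; rewrite eq_le H1 andbT.
by apply: H2; split=> // y; rewrite ord_ltx0.
Qed.

Lemma omega_mul_ltS g n : omega_pow g *o n < omega_pow g *o n.+1.
Proof. rewrite omulxS; apply: oadd_gt; exact: omega_pow_gt0. Qed.

Lemma omega_mul_lt g n p : (omega_pow g *o n < omega_pow g *o p) = (n < p)%N.
Proof.
have H q r : (q <= r)%N -> omega_pow g *o q <= omega_pow g *o r.
  by move=> qr; apply: omul_mono; rewrite onat_le.
apply/idP/idP; last by move=> /H; apply: lt_le_trans; exact: omega_mul_ltS.
by rewrite ltnNge; apply: contraTN => /H; rewrite leNgt.
Qed.

Lemma omega_mul_lt_pow g h n : g < h -> omega_pow g *o n < omega_pow h.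
Proof.
move=> gh; apply: lt_le_trans (omega_mul_ltS g n) _.
have [[_ H] _] := omega_pow_least h; apply: le_trans (H _ gh).
apply: omul_mono; apply: ltW; exact: onat_omega.
Qed.

Lemma omega_pow_lt g h : g < h -> omega_pow g < omega_pow h.
Proof. by move=> /(omega_mul_lt_pow 1); rewrite omulx1. Qed.

Lemma omega_pow_le g h : g <= h -> omega_pow g <= omega_pow h.
Proof. by rewrite le_eqVlt => /orP[/eqP ->//|/omega_pow_lt/ltW]. Qed.

(** Leastness of the power, in a form that keeps inductions on exponents uniform: zero, successor
    and limit [g] need no separate treatment. *)
Lemma lt_omega_pow g x : x < omega_pow g -> x = ozero \/
  exists h n, h < g /\ x < omega_pow h *o n.
Proof.
move=> xg; apply: contrapT => H.
suff : omega_pow g <= x by rewrite leNgt xg.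
have [_] := omega_pow_least g; apply; split.
  by rewrite osucc_le ord_lt0x; apply/eqP => x0; apply: H; left.
move=> h hg; rewrite leNgt; apply/negP => /lt_omul_omega[n xn].
by apply: H; right; exists h, n.
Qed.

Lemma omega_mul_le g h n : g <= h -> omega_pow g *o n <= omega_pow h *o n.
Proof.
by move=> gh; elim: n => [|n IH]; rewrite ?omulx0 // !omulxS; apply: oadd_leD (omega_pow_le _).
Qed.

(** The larger exponent with the sum of the two coefficients serves both arguments. *)
Lemma lt_omega_pow2 g x y : x < omega_pow g -> y < omega_pow g ->
  (x = ozero /\ y = ozero) \/
  exists h n, [/\ h < g, x < omega_pow h *o n & y < omega_pow h *o n].
Proof.
move=> /lt_omega_pow[->|[h [n [hg xn]]]] /lt_omega_pow[->|[h' [n' [hg' yn]]]].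
- by left.
- right; exists h', n'; split=> //; exact: le_lt_trans (ozero_le _) yn.
- right; exists h, n; split=> //; exact: le_lt_trans (ozero_le _) xn.
right; exists (Order.max h h'), (n + n')%N; split.
- by rewrite gt_max hg hg'.
- apply: lt_le_trans xn _; rewrite omulxD; apply: le_trans (oadd_lel _ _).
  by apply: omega_mul_le; rewrite le_max lexx.
apply: lt_le_trans yn _; rewrite omulxD; apply: le_trans (oadd_ler _ _).
by apply: omega_mul_le; rewrite le_max lexx orbT.
Qed.

Lemma omega_pow_add g x y : x < omega_pow g -> y < omega_pow g -> x +o y < omega_pow g.
Proof.
move=> xg yg; have [[-> ->]|[h [n [hg xn yn]]]] := lt_omega_pow2 xg yg.
  by rewrite oaddx0 omega_pow_gt0.
apply: le_lt_trans (omega_mul_lt_pow (n + n) hg); rewrite omulxD.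
by apply: oadd_leD; apply: ltW.
Qed.

Lemma omega_pow_absorb g x : x < omega_pow g -> x +o omega_pow g = omega_pow g.
Proof.
move=> xg; apply/eqP; rewrite eq_le oadd_ler andbT; apply: le_of_lt => z zx.
have [/lt_trans|xz] := ltP z x; first exact.
by have [y yg ->] := lt_oadd_ex zx xz; exact: omega_pow_add.
Qed.

Lemma omega_pow_div g n x : x < omega_pow g *o n ->
  exists l y, [/\ (l < n)%N, y < omega_pow g & x = omega_pow g *o l +o y].
Proof.
elim: n => [|n IH]; first by rewrite omulx0 ord_ltx0.
have [/IH[l [y [ln yg ->]]] _|nx] := ltP x (omega_pow g *o n).
  by exists l, y; split=> //; exact: ltnW.
by rewrite omulxS => /lt_oadd_ex/(_ nx)[y yg ->]; exists n, y.
Qed.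

Lemma le_omega_pow x : x <= omega_pow x.
Proof.
elim/ord_ind: x => x IH; apply: le_of_lt => y yx.
exact: le_lt_trans (IH _ yx) (omega_pow_lt yx).
Qed.

Lemma one_add_omega_mul a m : a != ozero -> (0 < m)%N ->
  onat 1 +o omega_pow a *o m = omega_pow a *o m.
Proof.
move=> a0; case: m => // m _; rewrite -[m.+1]add1n omulxD omulx1 oaddA omega_pow_absorb //.
by rewrite -omega_pow0; apply: omega_pow_lt; rewrite ord_lt0x.
Qed.

Lemma one_add_gt0 x : ozero < onat 1 +o x.
Proof. by apply: lt_le_trans (oadd_lel _ _); exact: osucc_gt. Qed.

Lemma one_add_ex y : ozero < y -> exists x, y = onat 1 +o x.
Proof. by move=> y0; apply: le_oadd_ex; rewrite osucc_le. Qed.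

(** For positive [a] the leading 1 is absorbed and the final [+ 1] of [omega_bar] turns [<] into
    [<=]; for [a = ozero] the shift by 1 does so. *)
Lemma lt_omega_bar a m x : (0 < m)%N ->
  (x < omega_bar a m) = (onat 1 +o x <= omega_pow a *o m).
Proof.
move=> m0; rewrite /omega_bar; case: eqP => [->|/eqP a0].
  rewrite omega_pow0 omul_onat mul1n; case: m m0 => // m _.
  by rewrite -add1n -onatD oadd_le2l onatD add1n lt_osucc.
by rewrite oaddx1 lt_osucc -{2}(one_add_omega_mul a0 m0) oadd_le2l.
Qed.

Lemma lt_lt_omega_bar a m b x : (0 < m)%N -> b < omega_bar a m -> x < b ->
  onat 1 +o x < omega_pow a *o m.
Proof.
move=> m0; rewrite lt_omega_bar // => H xb; apply: lt_le_trans H.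
by rewrite oadd_lt2l.
Qed.

(** * The natural sum *)

(* The natural sum is the least operation strictly increasing in both arguments
   (see [natsumE]). *)
Definition hsum : Ord -> Ord -> Ord :=
  Fix olt_wf (fun=> Ord -> Ord) (fun x recx =>
    Fix olt_wf (fun=> Ord) (fun y recy =>
      oleast [set z | (forall x' (h : x' < x), recx x' h y < z) /\
                      forall y' (h : y' < y), recy y' h < z])).

Lemma hsum_least x y :
  is_least [set z | (forall x', x' < x -> hsum x' y < z) /\
                    forall y', y' < y -> hsum x y' < z] (hsum x y).
Proof.
(* The outer recursion is unfolded first with the inner [Fix] left in place; unfolding that one then
   gives the equation for [hsum x y]. *)
have E : hsum x = Fix olt_wf (fun=> Ord) (fun y recy =>
    oleast [set z | (forall x', x' < x -> hsum x' y < z) /\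
                    forall y' (h : y' < y), recy y' h < z]).
  rewrite {1}/hsum Fix_eq // => u f g fg.
  suff -> : f = g by [].
  by apply: functional_extensionality_dep => v; apply/funext => h; exact: fg.
have {}E : hsum x y = oleast [set z |
    (forall x', x' < x -> hsum x' y < z) /\ forall y', y' < y -> hsum x y' < z].
  by rewrite {1}E oFixE -E.
rewrite E; apply: oleastP.
have [z zP] := ord_replacement (hsum^~ y) x.
have [t tP] := ord_replacement (hsum x) y.
exists (Order.max z t); split=> w /= h; rewrite lt_max ?zP ?tP ?orbT //.
Qed.

Lemma hsum_ltl x' x y : x' < x -> hsum x' y < hsum x y.
Proof. by have [[H _] _] := hsum_least x y; exact: H. Qed.

Lemma hsum_ltr x y' y : y' < y -> hsum x y' < hsum x y.
Proof. by have [[_ H] _] := hsum_least x y; exact: H. Qed.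

Lemma hsum_le x y z : (forall x', x' < x -> hsum x' y < z) ->
  (forall y', y' < y -> hsum x y' < z) -> hsum x y <= z.
Proof. by move=> H1 H2; have [_] := hsum_least x y; apply. Qed.

Lemma lt_hsum x y z : z < hsum x y ->
  (exists2 x', x' < x & z <= hsum x' y) \/ (exists2 y', y' < y & z <= hsum x y').
Proof.
move=> zxy; apply: contrapT => H; suff : hsum x y <= z by rewrite leNgt zxy.
apply: hsum_le => t tP; rewrite ltNge; apply/negP => zt; apply: H.
  by left; exists t.
by right; exists t.
Qed.

Lemma hsum_leD x x' y y' : x <= x' -> y <= y' -> hsum x y <= hsum x' y'.
Proof.
rewrite !le_eqVlt => /orP[/eqP <-|xx'] /orP[/eqP <-|yy'].
- by rewrite eqxx.
- by rewrite hsum_ltr ?orbT.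
- by rewrite hsum_ltl ?orbT.
by rewrite (lt_trans (hsum_ltl y xx') (hsum_ltr x' yy')) orbT.
Qed.

(** An ordinal below the left side but not below [hsum x y] is [hsum x y +o v] with
    [v < hsum x' y']. By [lt_hsum] one of [x'], [y'] can then be lowered, and the right side drops
    strictly with it. *)
Lemma hsum_superadd x y x' y' :
  hsum x y +o hsum x' y' <= hsum (x +o x') (y +o y').
Proof.
elim/ord_ind: x' y' => x' IHx; elim/ord_ind => y' IHy.
apply: le_of_lt => w wlt; have [wN|Nw] := ltP w (hsum x y).
  by apply: lt_le_trans wN _; apply: hsum_leD; exact: oadd_lel.
have [v /lt_hsum[[t tx' vt]|[t ty' vt]] ->] := lt_oadd_ex wlt Nw.
  apply: (@le_lt_trans _ _ (hsum (x +o t) (y +o y'))).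
    by apply: le_trans (IHx _ tx' _); rewrite oadd_le2l.
  by apply: hsum_ltl; rewrite oadd_lt2l.
apply: (@le_lt_trans _ _ (hsum (x +o x') (y +o t))).
  by apply: le_trans (IHy _ ty'); rewrite oadd_le2l.
by apply: hsum_ltr; rewrite oadd_lt2l.
Qed.

Lemma hsumz0 x : hsum x ozero = x.
Proof.
elim/ord_ind: x => x IH; apply/eqP; rewrite eq_le; apply/andP; split.
  by apply: hsum_le => t; rewrite ?ord_ltx0 // => tx; rewrite IH.
by apply: le_of_lt => t tx; rewrite -(IH _ tx) hsum_ltl.
Qed.

Lemma hsum0z x : hsum ozero x = x.
Proof.
elim/ord_ind: x => x IH; apply/eqP; rewrite eq_le; apply/andP; split.
  by apply: hsum_le => t; rewrite ?ord_ltx0 // => tx; rewrite IH.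
by apply: le_of_lt => t tx; rewrite -(IH _ tx) hsum_ltr.
Qed.

Lemma add_le_hsum x y : x +o y <= hsum x y.
Proof.
have := hsum_superadd x ozero ozero y.
by rewrite hsumz0 hsum0z oaddx0 oadd0x.
Qed.

(** One inequality is superadditivity. For the other, the right side is an admissible bound: a
    smaller argument has either a smaller leading coefficient or the same one with a smaller
    remainder. *)
Lemma hsum_powE g l n x y :
    (forall x y, x < omega_pow g -> y < omega_pow g -> hsum x y < omega_pow g) ->
    x < omega_pow g -> y < omega_pow g ->
  hsum (omega_pow g *o l +o x) (omega_pow g *o n +o y) =
  omega_pow g *o (l + n) +o hsum x y.
Proof.
move=> cl xg yg; apply/eqP; rewrite eq_le; apply/andP; split; last first.
  by apply: le_trans (hsum_superadd _ _ _ _); apply: oadd_le2r; rewrite omulxD add_le_hsum.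
have split (r : nat) z w : w < omega_pow g *o r +o z -> z < omega_pow g ->
    exists q u, [/\ w = omega_pow g *o q +o u, u < omega_pow g &
      (q < r)%N \/ q = r /\ u < z].
  move=> wlt zg; have [/omega_pow_div[q [u [qr ug ->]]]|rw] := ltP w (omega_pow g *o r).
    by exists q, u; split=> //; left.
  have [u uz ->] := lt_oadd_ex wlt rw; exists r, u; split=> //; last by right.
  exact: lt_trans uz zg.
move: l x xg n y yg.
(* Induction runs over the arguments [X], [Y] themselves, so that it also reaches decompositions
   with other coefficients. *)
suff H : forall X Y l x n y, X = omega_pow g *o l +o x ->
    Y = omega_pow g *o n +o y -> x < omega_pow g -> y < omega_pow g ->
    hsum X Y <= omega_pow g *o (l + n) +o hsum x y.
  by move=> l x xg n y yg; exact: H.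
elim/ord_ind => X IHX; elim/ord_ind => Y IHY l x n y EX EY xg yg.
(* A smaller leading coefficient leaves room for one more [omega_pow g], which by [cl] exceeds the
   sum of the remainders. *)
have step q u v : u < omega_pow g -> v < omega_pow g -> (q < l + n)%N ->
  omega_pow g *o q +o hsum u v < omega_pow g *o (l + n) +o hsum x y.
  move=> ug vg qrs; apply: lt_le_trans (oadd_lel _ _).
  apply: (@lt_le_trans _ _ (omega_pow g *o q.+1)).
    by rewrite omulxS oadd_lt2l; exact: cl.
  by apply: omul_mono; rewrite onat_le.
apply: hsum_le => w wlt.
  have := wlt; rewrite EX => /split/(_ xg)[q [u [Ew ug H]]].
  apply: (le_lt_trans (IHX _ wlt _ _ _ _ _ Ew EY ug yg)).
  case: H => [ql|[-> ux]]; last by rewrite oadd_lt2l; exact: hsum_ltl.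
  by apply: step; rewrite // ltn_add2r.
have := wlt; rewrite EY => /split/(_ yg)[q [u [Ew ug H]]].
apply: (le_lt_trans (IHY _ wlt _ _ _ _ EX Ew xg ug)).
case: H => [ql|[-> ux]]; last by rewrite oadd_lt2l; exact: hsum_ltr.
by apply: step; rewrite // ltn_add2l.
Qed.

(** Both arguments lie below a multiple of some [omega_pow h] with [h < g], and the induction
    hypothesis at [h] is the closure assumption of [hsum_powE]. *)
Lemma hsum_pow_lt g x y :
  x < omega_pow g -> y < omega_pow g -> hsum x y < omega_pow g.
Proof.
elim/ord_ind: g x y => g IH x y xg yg.
have [[-> ->]|[h [n [hg xn yn]]]] := lt_omega_pow2 xg yg; first by rewrite hsumz0 omega_pow_gt0.
have [l [u [_ uh ->]]] := omega_pow_div xn; have [r [v [_ vh ->]]] := omega_pow_div yn.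
rewrite hsum_powE //; last exact: IH.
apply: (@lt_trans _ _ (omega_pow h *o (l + r).+1)); last exact: omega_mul_lt_pow.
by rewrite omulxS oadd_lt2l; exact: IH.
Qed.

Lemma cnf_lt g s : path >%O g (map fst s) -> cnf s < omega_pow g.
Proof.
elim: s g => [|[h n] s IH] g /=; first by rewrite omega_pow_gt0.
move=> /andP[hg /IH sh]; apply: lt_trans (omega_mul_lt_pow n.+1 hg).
by rewrite omulxS oadd_lt2l.
Qed.

Lemma is_natsum_hsum x y z : is_natsum x y z -> z = hsum x y.
Proof.
move=> [s [srt -> -> ->]]; elim: s srt => [|[g [l n]] s IH] /= srt.
  by rewrite hsumz0.
rewrite hsum_powE ?IH ?(path_sorted srt) //; first exact: hsum_pow_lt.
  by apply: cnf_lt; rewrite -map_comp.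
by apply: cnf_lt; rewrite -map_comp.
Qed.

(** Dividing both arguments by the same [omega_pow h] yields one shared term, possibly with a
    coefficient 0; the remainders lie below [omega_pow h], so later exponents are smaller. *)
Lemma is_natsum_ex x y : exists z, is_natsum x y z.
Proof.
suff H g : x < omega_pow g -> y < omega_pow g ->
    exists s : seq (Ord * (nat * nat)),
    [/\ path >%O g (map fst s), x = cnf [seq (t.1, t.2.1) | t <- s] &
        y = cnf [seq (t.1, t.2.2) | t <- s]].
  have big t : t <= Order.max x y -> t < omega_pow (osucc (Order.max x y)).
    by rewrite -lt_osucc => tm; exact: le_lt_trans (le_omega_pow t) (omega_pow_lt tm).
  have [||s [/path_sorted srt xs ys]] := H (osucc (Order.max x y)).
  - by apply: big; rewrite le_max lexx.
  - by apply: big; rewrite le_max lexx orbT.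
  by exists (cnf [seq (t.1, (t.2.1 + t.2.2)%N) | t <- s]), s.
elim/ord_ind: g x y => g IH x y xg yg.
have [[-> ->]|[h [n [hg xn yn]]]] := lt_omega_pow2 xg yg; first by exists [::].
have [l [u [_ uh ->]]] := omega_pow_div xn; have [r [v [_ vh ->]]] := omega_pow_div yn.
have [s [ps -> ->]] := IH _ hg _ _ uh vh.
by exists ((h, (l, r)) :: s); split=> //=; rewrite ps andbT.
Qed.

Lemma natsumP x y : is_natsum x y (natsum x y).
Proof. by have [z zP] := is_natsum_ex x y; apply: (xgetI _ zP). Qed.

Lemma natsumE x y : natsum x y = hsum x y.
Proof. exact/is_natsum_hsum/natsumP. Qed.

(** * Splitting a natural sum into pieces *)

(* [z] is the union of pieces of order types at most [a i]: [col] selects the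
   piece and [r] gives the position inside it. *)
Definition ord_split (I : Type) (a : I -> Ord) (z : Ord) :=
  exists (col : Ord -> option I) (r : Ord -> Ord),
    (forall g, g < z -> exists2 i, col g = Some i & r g < a i) /\
    (forall g h, g < h -> h < z -> col g = col h -> r g < r h).

(** The pieces of [y] are placed after those of [x]: inside piece [i], positions coming from [y] are
    shifted by [a i]. *)
Lemma ord_split_add (I : Type) (a b c : I -> Ord) x y :
    (forall i, c i = a i +o b i) ->
    ord_split a x -> ord_split b y -> ord_split c (x +o y).
Proof.
move=> E [ca [ra [ra1 ra2]]] [cb [rb [rb1 rb2]]].
have /choice[sub subP] : forall g, exists h, x <= g -> g = x +o h.
  move=> g; have [xg|] := boolP (x <= g); last by exists ozero.
  by have [h ->] := le_oadd_ex xg; exists h.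
pose d := fun g => if cb (sub g) is Some i then a i else ozero.
exists (fun g => if g < x then ca g else cb (sub g)),
       (fun g => if g < x then ra g else d g +o rb (sub g)).
have ltsub g : x <= g -> g < x +o y -> sub g < y.
  by move=> /subP E1; rewrite {1}E1 oadd_lt2l.
split=> [g gz|g h gh hz].
  case: (ltP g x) => [gx|xg].
    have [i ci ri] := ra1 _ gx; exists i => //; rewrite E.
    exact: lt_le_trans ri (oadd_lel _ _).
  have [i ci ri] := rb1 _ (ltsub _ xg gz); exists i => //.
  by rewrite /d ci E oadd_lt2l.
case: (ltP h x) => [hx|xh].
  by rewrite (lt_trans gh hx); exact: ra2.
have [i ci ri] := rb1 _ (ltsub _ xh hz).
case: (ltP g x) => [gx|xg] Ec.
  have [j cj rj] := ra1 _ gx; move: Ec; rewrite /d ci cj => -[ji].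
  by rewrite -ji; apply: lt_le_trans rj (oadd_lel _ _).
rewrite /d Ec oadd_lt2l; apply: rb2 => //; last exact: ltsub.
by rewrite -(oadd_lt2l x) -!subP.
Qed.

Lemma ord_split_single (I : eqType) (i : I) z :
  ord_split (fun j => if j == i then z else ozero) z.
Proof. by exists (fun=> Some i), id; split=> // g gz; exists i; rewrite ?eqxx. Qed.

(** Each term [omega^g * (l + n)] of the shared normal form is a block of piece [true] followed by a
    block of piece [false]; the terms are then stacked. *)
Lemma ord_split_natsum x y :
  ord_split (fun b : bool => if b then x else y) (natsum x y).
Proof.
have [s [_ Ex Ey ->]] := natsumP x y; rewrite {}Ex {}Ey.
elim: s => [|[g [l n]] s IH] /=.
  by exists (fun=> None), id; split=> h; rewrite ?ord_ltx0 // => ? _; rewrite ord_ltx0.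
apply: (ord_split_add (a := fun b : bool => if b then omega_pow g *o l else omega_pow g *o n) _ _ IH).
  by case.
rewrite omulxD.
apply: (ord_split_add _ (ord_split_single true _) (ord_split_single false _)).
by case; rewrite /= ?oaddx0 ?oadd0x.
Qed.

Lemma ord_split_big_natsum k (a : 'I_k -> Ord) : ord_split a (\big[natsum/ozero]_(i < k) a i).
Proof.
elim: k a => [|k IH] a.
  rewrite big_ord0; exists (fun=> None), id.
  by split=> h; rewrite ?ord_ltx0 // => ? _; rewrite ord_ltx0.
rewrite big_ord_recl; set b := \big[_/_]_(_ < _) _.
have [c2 [r2 [r21 r22]]] := ord_split_natsum (a ord0) b.
have [c1 [r1 [r11 r12]]] := IH (fun i => a (lift ord0 i)); rewrite -/b in r11 r12.
(* Index [ord0] takes piece [true] of the binary splitting; piece [false] is split again according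
   to the position [r2 g] inside it. *)
exists (fun g => if c2 g is Some false then omap (lift ord0) (c1 (r2 g)) else Some ord0),
  (fun g => if c2 g is Some false then r1 (r2 g) else r2 g); split=> [g gz|g h gh hz].
  have [[] -> rg] := r21 _ gz; first by exists ord0.
  by have [i -> ri] := r11 _ rg; exists (lift ord0 i).
have [u cg rg] := r21 _ (lt_trans gh hz); have [v ch rh] := r21 _ hz.
move: (r22 _ _ gh hz) rg rh; rewrite cg ch; case: u {cg}; case: v {ch} => //.
- by move=> H _ _ _; exact: H.
- move=> _ _ rh; have [i -> _] := r11 _ rh.
  by move=> /Some_inj E; have := neq_lift ord0 i; rewrite -E eqxx.
- move=> _ rg _; have [i -> _] := r11 _ rg.
  by move=> /Some_inj E; have := neq_lift ord0 i; rewrite E eqxx.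
move=> H rg rh E; apply: r12 => //; first exact: H.
move: E; have [i -> _] := r11 _ rg; have [j -> _] := r11 _ rh.
by move=> /Some_inj/lift_inj ->.
Qed.

Lemma big_natsum_le k (a b : 'I_k -> Ord) : (forall i, a i <= b i) ->
  \big[natsum/ozero]_(i < k) a i <= \big[natsum/ozero]_(i < k) b i.
Proof.
elim: k a b => [|k IH] a b ab; first by rewrite !big_ord0.
by rewrite !big_ord_recl !natsumE; apply: hsum_leD => //; exact: IH.
Qed.

Lemma big_natsum_lt k (a b : 'I_k -> Ord) j : (forall i, a i <= b i) -> a j < b j ->
  \big[natsum/ozero]_(i < k) a i < \big[natsum/ozero]_(i < k) b i.
Proof.
elim: k a b j => [|k IH] a b j ab; first by case: j.
rewrite !big_ord_recl !natsumE.
have [j' ->|->] := unliftP ord0 j => abj.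
  apply: (@lt_le_trans _ _ (hsum (a ord0) (\big[natsum/ozero]_(i < k) b (lift ord0 i)))).
    by apply: hsum_ltr; apply: IH abj.
  exact: hsum_leD.
apply: lt_le_trans (hsum_ltl _ abj) _; apply: hsum_leD => //.
exact: big_natsum_le.
Qed.

(** * Closure of the countable ordinals under the operations *)

Lemma countable_setU (T : Type) (A B : set T) :
  countable A -> countable B -> countable (A `|` B).
Proof.
move=> cA cB; rewrite -bigcup2inE.
by apply: bigcup_countable => // -[|[|]].
Qed.

Lemma countable_image (T U : Type) (f : T -> U) (A : set T) :
  countable A -> countable (f @` A).
Proof. exact/sub_countable/card_image_le. Qed.

(** A countable union of countable initial segments is countable. Each closure proof below takes for
    [A] the values at smaller arguments, which the recursion makes cofinal. *)
Lemma countable_ord (z : Ord) (A : set Ord) : countable A ->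
  (forall x, A x -> x < omega1) -> (forall y, y < z -> exists2 x, A x & y <= x) ->
  z < omega1.
Proof.
move=> cA A1 zA; apply/lt_omega1.
have : countable (\bigcup_(x in A) [set y | y < osucc x]).
  apply: bigcup_countable => // x /A1 /lt_omega1 cx.
  apply: sub_countable (countable_setU cx (countable1 x)).
  by apply: subset_card_le => y /=; rewrite lt_osucc le_eqVlt => /orP[/eqP|]; [right|left].
apply: sub_countable; apply: subset_card_le => y /= /zA[x Ax yx].
by exists x => //=; rewrite lt_osucc.
Qed.

Lemma zero_omega1 : ozero < omega1.
Proof. by apply: (@countable_ord _ set0) => // y; rewrite ord_ltx0. Qed.

Lemma oadd_omega1 x y : x < omega1 -> y < omega1 -> x +o y < omega1.
Proof.
move=> x1; elim/ord_ind: y => y IH y1.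
apply: (@countable_ord _ ([set x] `|` (oadd x) @` [set z | z < y])).
- apply: countable_setU; first exact: countable1.
  by apply: countable_image; apply/lt_omega1.
- by move=> _ [->//|[z zy <-]]; apply: IH => //; exact: lt_trans zy y1.
move=> z zxy; have [zx|xz] := ltP z x; first by exists x; [left|exact: ltW].
by have [w wy ->] := lt_oadd_ex zxy xz; exists (x +o w) => //; right; exists w.
Qed.

Lemma omul_omega1 x n : x < omega1 -> x *o n < omega1.
Proof.
move=> x1; elim: n => [|n IH]; first by rewrite omulx0 zero_omega1.
by rewrite omulxS; exact: oadd_omega1.
Qed.

Lemma omega_pow_omega1 g : g < omega1 -> omega_pow g < omega1.
Proof.
elim/ord_ind: g => g IH g1.
apply: (@countable_ord _ ([set ozero] `|`
    \bigcup_(h in [set h | h < g]) range (fun n => omega_pow h *o n))).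
- apply: countable_setU; first exact: countable1.
  apply: bigcup_countable; first exact/lt_omega1.
  by move=> h _; apply: countable_image.
- move=> _ [->|[h /= hg [n _ <-]]]; first exact: zero_omega1.
  by apply/omul_omega1/IH => //; exact: lt_trans hg g1.
move=> y /lt_omega_pow[->|[h [n [hg yn]]]]; first by exists ozero => //; left.
by exists (omega_pow h *o n); [right; exists h => //; exists n|exact: ltW].
Qed.

Lemma hsum_omega1 x y : x < omega1 -> y < omega1 -> hsum x y < omega1.
Proof.
elim/ord_ind: x y => x IHx; elim/ord_ind => y IHy x1 y1.
apply: (@countable_ord _ ((hsum^~ y) @` [set z | z < x] `|` (hsum x) @` [set z | z < y])).
- by apply: countable_setU;
    apply: countable_image; apply/lt_omega1.
- move=> _ [[z zx <-]|[z zy <-]]; first exact: IHx (lt_trans zx x1) y1.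
  exact: IHy x1 (lt_trans zy y1).
move=> z /lt_hsum[[t tx zt]|[t ty zt]].
  by exists (hsum t y) => //; left; exists t.
by exists (hsum x t) => //; right; exists t.
Qed.

Lemma big_natsum_omega1 k (a : 'I_k -> Ord) : (forall i, a i < omega1) ->
  \big[natsum/ozero]_(i < k) a i < omega1.
Proof.
move=> a1; apply: (big_ind (fun x => x < omega1)) => //; first exact: zero_omega1.
by move=> x y x1 y1; rewrite natsumE; exact: hsum_omega1.
Qed.

(** * Cantor-Bendixson rank and normal functions *)

(* [cb_ge X a p]: the Cantor-Bendixson rank of [p] in [X `|` [set p]] is at least
   [a]; neighbourhoods of [p] need only be tested below [p], since [(u, p]] is
   open in the order topology. *)
Inductive cb_ge (X : set Ord) : Ord -> Ord -> Prop :=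
  CbGe a p of (forall b u, b < a -> u < p ->
    exists q, [/\ u < q, q < p, X q & cb_ge X b q]) : cb_ge X a p.

Lemma cb_geE X a p : cb_ge X a p <-> (forall b u, b < a -> u < p ->
  exists q, [/\ u < q, q < p, X q & cb_ge X b q]).
Proof. by split=> [[]|]; [|exact: CbGe]. Qed.

Lemma not_cb_ge X a p : ~ cb_ge X a p -> exists b u, [/\ b < a, u < p &
  forall q, u < q -> q < p -> X q -> ~ cb_ge X b q].
Proof.
rewrite cb_geE => H; apply: contrapT => H1; apply: H => b u ba up.
apply: contrapT => H2; apply: H1; exists b, u; split=> // q uq qp Xq bq.
by apply: H2; exists q.
Qed.

Lemma cb_ge_le X a b p : b <= a -> cb_ge X a p -> cb_ge X b p.
Proof.
move=> ba /cb_geE H; apply/cb_geE => c u cb; apply: H; exact: lt_le_trans ba.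
Qed.

(** Start at a [w] that reaches [v] and add [omega_pow b]: the endpoint has rank at least [b] by
    induction and stays below [omega_pow a]. *)
Lemma cb_ge_pow a u : cb_ge setT a (u +o omega_pow a).
Proof.
elim/ord_ind: a u => a IH u; apply/cb_geE => b v ba vlt.
have [w wa vw] : exists2 w, w < omega_pow a & v <= u +o w.
  have [vu|uv] := ltP v u.
    by exists ozero; [exact: omega_pow_gt0|rewrite oaddx0 ltW].
  by have [w wa ->] := lt_oadd_ex vlt uv; exists w.
exists (u +o (w +o omega_pow b)); split=> //.
- by apply: le_lt_trans vw _; rewrite oadd_lt2l oadd_gt // omega_pow_gt0.
- by rewrite oadd_lt2l; apply: omega_pow_add => //; exact: omega_pow_lt.
by rewrite oaddA; exact: IH.
Qed.

(** Divide [x] by some [omega_pow g] with [g < a]. A nonzero remainder contradicts the induction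
    hypothesis at [g] directly; otherwise rank [a] would force a point of rank [g] strictly inside
    the last block [omega_pow g], again impossible. *)
Lemma not_cb_ge_inner a v x : ozero < x -> x < omega_pow a -> ~ cb_ge setT a (v +o x).
Proof.
elim/ord_ind: a v x => a IH v x x0 /lt_omega_pow[xE|]; first by rewrite xE ltxx in x0.
move=> [g [n [ga]]] /omega_pow_div[l [y [_ yg xE]]]; subst x.
have [y0|] := boolP (y == ozero); last first.
  rewrite -ord_lt0x => y0 /(cb_ge_le (ltW ga)); rewrite oaddA; exact: IH.
rewrite (eqP y0) oaddx0 in x0 *; case: l x0 => [|l] x0; first by rewrite omulx0 ltxx in x0.
rewrite omulxS oaddA => /cb_geE/(_ _ _ ga (oadd_gt _ (omega_pow_gt0 g)))[q [q1 q2 _]].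
have [z zg Eq] := lt_oadd_ex q2 (ltW q1); rewrite Eq.
by apply: IH => //; rewrite -(oadd_lt2l (v +o omega_pow g *o l)) oaddx0 -Eq.
Qed.

Lemma cb_ge_mul a n : (0 < n)%N -> cb_ge setT a (omega_pow a *o n).
Proof. by case: n => // n _; rewrite omulxS; exact: cb_ge_pow. Qed.

Lemma cb_ge_multiple a n y : ozero < y -> y < omega_pow a *o n -> cb_ge setT a y ->
  exists2 j, (0 < j < n)%N & y = omega_pow a *o j.
Proof.
move=> y0 /omega_pow_div[l [x [ln xa yE]]]; subst y.
have [/eqP x0|] := boolP (x == ozero); last by rewrite -ord_lt0x => x0 /(not_cb_ge_inner x0).
move: y0; rewrite x0 oaddx0 => y0 _; exists l => //; rewrite ln andbT.
by case: l y0 {ln} => //; rewrite omulx0 ltxx.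
Qed.

Lemma cb_ge_color k (X : 'I_k -> set Ord) t (a : 'I_k -> Ord) p u :
    (forall q, ozero < q -> q <= t -> exists i, X i q) ->
    cb_ge setT (\big[natsum/ozero]_(i < k) a i) p -> p <= t -> u < p ->
  exists i q, [/\ u < q, q <= p, X i q & cb_ge (X i) (a i) q].
Proof.
move=> cov; move Ez: (\big[_/_]_(_ < _) _) => z.
elim/ord_ind: z a Ez p u => z IH a Ez p u zp pt up.
have [j Xj] := cov p (le_lt_trans (ozero_le _) up) pt.
have [jp|/not_cb_ge[b [v [ba vp H]]]] := pselect (cb_ge (X j) (a j) p).
  by exists j, p.
pose a' i := if i == j then b else a i.
have a'z : \big[natsum/ozero]_(i < k) a' i < z.
  rewrite -Ez; apply: (@big_natsum_lt _ _ _ j); last by rewrite /a' eqxx.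
  by move=> i; rewrite /a'; case: eqP => [->|//]; exact: ltW.
(* Staying above [v] keeps the bound [b] on ranks in [X j] valid for the point found in the end; if
   its colour is [j], this is a contradiction. *)
have maxp : Order.max u v < p by rewrite gt_max up vp.
move/cb_geE: zp => /(_ _ _ a'z maxp)[q []]; rewrite gt_max => /andP[uq vq] qp _ rq.
have maxq : Order.max u v < q by rewrite gt_max uq vq.
have [i [r []]] := IH _ a'z a' erefl q _ rq (ltW (lt_le_trans qp pt)) maxq.
rewrite gt_max => /andP[ur vr] rq' Xr; rewrite /a'; case: eqP => [ij|_] rr.
  by rewrite ij in Xr rr; case: (H r vr (le_lt_trans rq' qp) Xr rr).
by exists i, r; split=> //; exact: ltW (le_lt_trans rq' qp).
Qed.

(** * Closed copies of multiples of powers of [omega] *)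

(* [f] maps the interval [(0, t]] of ordinals increasingly and continuously into
   [X] intersected with [(u, p]]; its values outside [(0, t]] are junk. *)
Definition normal_on (X : set Ord) (t u p : Ord) (f : Ord -> Ord) :=
  [/\ forall x, ozero < x -> x <= t -> [/\ u < f x, f x <= p & X (f x)],
      forall x y, ozero < x -> x < y -> y <= t -> f x < f y &
      forall x v, ozero < x -> x <= t -> v < f x ->
        exists2 w, w < x & forall y, w < y -> y < x -> v < f y].

(** The [xget] is subtraction of [t] on the left, which is unambiguous by [oaddI]; its default is
    not reached when [t < x]. *)
Definition splice (t : Ord) (f g : Ord -> Ord) (x : Ord) : Ord :=
  if x <= t then f x else g (xget ozero [set y | x = t +o y]).

Lemma splice_r t f g x : ozero < x -> splice t f g (t +o x) = g x.
Proof.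
move=> x0; rewrite /splice leNgt oadd_gt //=; congr g.
by have /= /oaddI := @xgetI _ ozero [set y | t +o x = t +o y] x erefl.
Qed.

(** The values of [g] lie above [p], hence above those of [f]. Continuity asks nothing new at the
    seam: [t] belongs to the first interval, and points after it have left neighbourhoods that start
    no earlier than [t]. *)
Lemma splice_normal X t s u p q f g : u <= p -> p <= q ->
  normal_on X t u p f -> normal_on X s p q g ->
  normal_on X (t +o s) u q (splice t f g).
Proof.
move=> up pq [f1 f2 f3] [g1 g2 g3].
have cl x : x <= t -> splice t f g x = f x by rewrite /splice => ->.
have split x : x <= t +o s -> x <= t \/ exists y, [/\ x = t +o y, ozero < y & y <= s].
  move=> xts; have [xt|tx] := leP x t; [by left|right].
  have [y E] := le_oadd_ex (ltW tx); exists y; subst x; split=> //.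
    by rewrite -(oadd_lt2l t) oaddx0.
  by rewrite -(oadd_le2l t).
split.
- move=> x x0 /split[xt|[y [-> y0 ys]]].
    by rewrite cl //; have [H1 H2 H3] := f1 _ x0 xt; split=> //; exact: le_trans pq.
  rewrite splice_r //; have [H1 H2 H3] := g1 _ y0 ys; split=> //.
  exact: le_lt_trans up H1.
- move=> x y x0 xy /split[yt|[y' [Ey y0 ys]]].
    by rewrite !cl ?(ltW (lt_le_trans xy yt)) //; exact: f2.
  have xts : x <= t +o s by rewrite (le_trans (ltW xy)) // Ey oadd_le2l.
  move/split: xts => [xt|[x' [Ex x'0 xs]]].
    rewrite cl // Ey splice_r //; have [_ H _] := f1 _ x0 xt.
    by apply: le_lt_trans H _; have [] := g1 _ y0 ys.
  by move: xy; rewrite Ex Ey !splice_r // oadd_lt2l => xy; exact: g2.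
move=> x v x0 /split[xt|[y [Ex y0 ys]]].
  rewrite cl // => /(f3 _ _ x0 xt)[w wx H]; exists w => // y wy yx.
  by rewrite cl ?(ltW (lt_le_trans yx xt)) //; exact: H.
rewrite Ex splice_r // => /(g3 _ _ y0 ys)[w wy H]; exists (t +o w); first by rewrite oadd_lt2l.
move=> z wz zx; have [z' E] := le_oadd_ex (ltW (le_lt_trans (oadd_lel _ _) wz)).
move: wz zx; rewrite E !oadd_lt2l => wz zy; rewrite splice_r; first exact: H.
exact: le_lt_trans (ozero_le _) wz.
Qed.

Lemma chain_normal X (t : nat -> Ord) (q : nat -> Ord) (f : nat -> Ord -> Ord) n :
  (forall i, (i < n)%N -> q i < q i.+1) ->
  (forall i, (i < n)%N -> normal_on X (t i) (q i) (q i.+1) (f i)) ->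
  let: s := fun n => iteri n (fun i x => x +o t i) ozero in
  normal_on X (s n) (q 0%N) (q n)
    (iteri n (fun i g => splice (s i) g (f i)) (f 0%N)).
Proof.
elim: n => [|n IH] qlt fn /=.
  (* The empty chain has domain [(0, 0]], which is empty, so its base function is arbitrary. *)
  split=> x => [x0|y x0 xy|v x0]; rewrite ord_lex0 => /eqP E.
  - by rewrite E ltxx in x0.
  - by rewrite E ord_ltx0 in xy.
  - by rewrite E ltxx in x0.
apply: (@splice_normal _ _ _ _ (q n)); last exact: fn.
- elim: n {IH fn} qlt => [|n IH] qlt //; apply: le_trans (IH _) (ltW (qlt _ _)) => //.
  by move=> i /ltnW; exact: qlt.
- by apply/ltW/qlt.
by apply: IH => i /ltnW; [exact: qlt|exact: fn].
Qed.

Lemma countable_surj x : x < omega1 -> ozero < x ->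
  exists e : nat -> Ord, (forall n, e n < x) /\ (forall y, y < x -> exists n, e n = y).
Proof.
move=> /lt_omega1/countable_injP[g ginj] x0.
(* [e] inverts the injection [g]; numbers outside the image only need some value below [x], and
   [ozero] is one. *)
have /choice[e eP] : forall n, exists y, y < x /\
    ((exists2 z, z < x & g z = n) -> g y = n).
  move=> n; have [[z zx gz]|H] := pselect (exists2 z, z < x & g z = n).
    by exists z.
  by exists ozero; split=> // /H.
exists e; split=> [n|y yx]; first by have [] := eP n.
exists (g y); have [H1 H2] := eP (g y).
by apply: ginj; rewrite ?inE //=; apply: H2; exists y.
Qed.

(** Points [q n.+1] of [X] climb to [p], with rank at least [b n] in [X]. By induction each gap
    [(q n, q n.+1]] receives a copy of [omega^(b n)]; these are chained, their lengths sum to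
    [omega^a], and [p] is put on top. *)
Lemma cb_ge_normal X a p u : a < omega1 -> p < omega1 -> X p -> cb_ge X a p -> u < p ->
  exists f, normal_on X (omega_pow a) u p f.
Proof.
elim/ord_ind: a p u => a IH p u a1 p1 Xp rp up.
have [/eqP a0|] := boolP (a == ozero).
  exists (fun=> p); rewrite a0 omega_pow0; split=> [x _ _|x y x0 xy|x v x0 xt vp] //.
    by move/(lt_le_trans xy); rewrite lt_osucc leNgt x0.
  by exists ozero.
rewrite -ord_lt0x => a0.
have p0 : ozero < p by exact: le_lt_trans (ozero_le _) up.
have [e [ea eP]] := countable_surj a1 a0; have [w [wp wP]] := countable_surj p1 p0.
(* Running maxima of the enumeration [e] of [a]: each [g < a] is below or equal to all late
   [b n]. *)
pose b n := iteri n (fun i x => Order.max x (e i)) (e 0%N).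
have ba n : b n < a by elim: n => [|n IHn] //=; rewrite gt_max IHn ea.
have eb n m : (n < m)%N -> e n <= b m.
  elim: m => // m IHm; rewrite ltnS leq_eqVlt /= => /orP[/eqP ->|/IHm H].
    by rewrite le_max lexx orbT.
  by rewrite le_max H.
(* The next point must also pass [w n]; as [w] enumerates the ordinals below [p], this makes [q]
   cofinal in [p]. *)
have /choice[nxt nxtP] : forall nq : nat * Ord, exists q', nq.2 < p ->
    [/\ nq.2 < q', w nq.1 < q', q' < p, X q' & cb_ge X (b nq.1) q'].
  move=> [n q]; have [qp|] := boolP (q < p); last by exists ozero.
  move/cb_geE: rp => /(_ (b n) (Order.max q (w n)) (ba n)).
  rewrite gt_max qp wp => /(_ isT)[q' []]; rewrite gt_max => /andP[? ?] ? ? ?.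
  by exists q'.
pose q n := iteri n (fun i x => nxt (i, x)) u.
have qp n : q n < p.
  by elim: n => //= n qp; have [] := nxtP (n, q n) qp.
have qP n : [/\ q n < q n.+1, w n < q n.+1, X (q n.+1) & cb_ge X (b n) (q n.+1)].
  by have [] := nxtP (n, q n) (qp n).
have /choice[f fP] : forall n, exists f, normal_on X (omega_pow (b n)) (q n) (q n.+1) f.
  move=> n; have [q1 _ q2 q3] := qP n; apply: IH => //.
    exact: lt_trans (ba n) a1.
  exact: lt_trans (qp _) p1.
pose s n := iteri n (fun i x => x +o omega_pow (b i)) ozero.
pose h n := iteri n (fun i g => splice (s i) g (f i)) (f 0%N).
have hP n : normal_on X (s n) u (q n) (h n).
  by apply: chain_normal => // i _; have [] := qP i.
have sS n : s n.+1 = s n +o omega_pow (b n) by [].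
have s_le n m : (n <= m)%N -> s n <= s m.
  move=> /subnK <-; elim: (m - n)%N => // d IHd.
  by rewrite addSn sS; apply: le_trans IHd (oadd_lel _ _).
have hE n m x : (n <= m)%N -> x <= s n -> h m x = h n x.
  move=> nm xn; move/subnK: nm => <-; elim: (m - n)%N => // d IHd.
  rewrite addSn /= /splice (le_trans xn) ?IHd //; apply: s_le; exact: leq_addl.
have s_lt n : s n < omega_pow a.
  by elim: n => [|n IHn]; [exact: omega_pow_gt0|rewrite sS omega_pow_add // omega_pow_lt].
have s_cof x : x < omega_pow a -> exists n, x <= s n.
  move=> /lt_omega_pow[->|[g [n [/eP[i <-] xn]]]]; first by exists 0%N; exact: ozero_le.
  (* From index [i.+1] on every summand is at least [omega_pow (e i)], so [n] further summands
     suffice. *)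
  exists (i.+1 + n)%N; apply: le_trans (ltW xn) _ => {xn}.
  elim: n => [|n IHn]; first by rewrite omulx0 ozero_le.
  rewrite omulxS addnS sS; apply: oadd_leD IHn (omega_pow_le _); apply: eb.
  by rewrite ltnS leq_addr.
have /choice[N NP] : forall x, exists n, x < omega_pow a -> x <= s n.
  move=> x; have [/s_cof[n xn]|] := boolP (x < omega_pow a); last by exists 0%N.
  by exists n.
(* [N x] is a stage whose domain contains [x]; by [hE] the value does not depend on the stage. *)
pose F x := if x < omega_pow a then h (N x) x else p.
have FE n x : x <= s n -> F x = h n x.
  move=> xn; have xa := le_lt_trans xn (s_lt n); rewrite /F xa.
  have [nN|/ltnW Nn] := leqP n (N x); first exact: hE.
  by rewrite (hE _ _ _ Nn) // NP.
have Fp x : x < omega_pow a -> ozero < x -> [/\ u < F x, F x < p & X (F x)].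
  move=> /s_cof[n xn] x0; rewrite (FE _ _ xn).
  have [H _ _] := hP n; have [H1 H2 H3] := H _ x0 xn; split=> //.
  exact: le_lt_trans (qp n).
have Fa : F (omega_pow a) = p by rewrite /F ltxx.
have Fmono x y : ozero < x -> x < y -> y <= omega_pow a -> F x < F y.
  move=> x0 xy; rewrite le_eqVlt => /orP[/eqP ya|/s_cof[n yn]].
    by rewrite ya Fa; rewrite ya in xy; have [] := Fp _ xy x0.
  rewrite (FE _ _ yn) (FE n) ?(ltW (lt_le_trans xy yn)) //.
  by have [_ H _] := hP n; exact: H.
exists F; split=> //.
  move=> x x0; rewrite le_eqVlt => /orP[/eqP ->|xa]; first by rewrite Fa.
  by have [? /ltW ? ?] := Fp _ xa x0.
move=> x v x0; rewrite le_eqVlt => /orP[/eqP ya|/s_cof[n yn]].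
  (* Continuity at the top: [F (s n.+2)] lies in the gap above [q n.+1], and [q n.+1] exceeds
     [w n]. *)
  rewrite ya Fa => /wP[n <-]; exists (s n.+2) => // y sy ya'.
  have [_ wq _ _] := qP n; apply: lt_trans wq _.
  apply: (@lt_trans _ _ (F (s n.+2))); last first.
    apply: Fmono (ltW ya') => //; rewrite sS; apply: lt_le_trans (oadd_ler _ _).
    exact: omega_pow_gt0.
  rewrite (FE n.+2) // /h iteriS -/(s _) -/(h _) sS splice_r ?omega_pow_gt0 //.
  by have [H _ _] := fP n.+1; have [] := H _ (omega_pow_gt0 _) (lexx _).
rewrite (FE _ _ yn) => vx; have [_ _ H] := hP n.
have [z zx zH] := H _ _ x0 yn vx; exists z => // y zy yx.
by rewrite (FE n) ?(ltW (lt_le_trans yx yn)) //; exact: zH.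
Qed.

Lemma cb_ge_normal_mul X a (q : nat -> Ord) n : a < omega1 ->
    (forall i, (i < n)%N ->
       [/\ q i < q i.+1, q i.+1 < omega1, X (q i.+1) & cb_ge X a (q i.+1)]) ->
  exists f, normal_on X (omega_pow a *o n) (q 0%N) (q n) f.
Proof.
move=> a1 qP.
have /choice[f fP] : forall i, exists f, (i < n)%N ->
    normal_on X (omega_pow a) (q i) (q i.+1) f.
  move=> i; case: (ltnP i n) => [/qP[q1 q2 q3 q4]|_]; last by exists id.
  by have [f fP] := cb_ge_normal a1 q2 q3 q4 q1; exists f.
have -> : omega_pow a *o n = iteri n (fun _ x => x +o omega_pow a) ozero.
  by elim: n {qP fP} => [|n IH]; rewrite ?omulx0 // omulxS IH.
eexists; apply: (@chain_normal _ (fun=> omega_pow a) q f) => i i_lt; last exact: fP.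
by have [] := qP _ i_lt.
Qed.

(** * Colourings of finite sets and topology of segments *)

(** Pigeonhole: if every fibre had at most [m i - 1] elements, they could not cover [M] indices. [J]
    lists a large fibre in increasing order. *)
Lemma increasing_fibre k (m : 'I_k -> nat) (col : nat -> 'I_k) M :
    (\sum_(i < k) (m i - 1) < M)%N ->
  exists i (J : nat -> nat),
    (forall j, (j < m i)%N -> (J j < M)%N /\ col (J j) = i) /\
    (forall j, (j.+1 < m i)%N -> (J j < J j.+1)%N).
Proof.
move=> ltM; pose s i := [seq j <- iota 0 M | col j == i].
have sum_s : (\sum_(i < k) size (s i) = M)%N.
  rewrite -[RHS](size_iota 0 M) -sum1_size (partition_big col predT) //=.
  by apply: eq_bigr => i _; rewrite -sum1_size big_filter.
have [i mi] : exists i, (m i <= size (s i))%N.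
  apply: contrapT => H; move: ltM; rewrite -{1}sum_s ltnNge => /negP; apply.
  apply: leq_sum => i _; rewrite leqNgt; apply/negP => lt; apply: H; exists i.
  by move: lt; case: (m i) => // n; rewrite subn1.
exists i, (nth 0%N (s i)); split=> j jm.
  have : nth 0%N (s i) j \in s i by rewrite mem_nth // (leq_trans jm).
  by rewrite mem_filter mem_iota add0n /= => /andP[/eqP -> ->].
have srt : sorted ltn (s i) by apply: sorted_filter (iota_ltn_sorted 0 M); exact: ltn_trans.
by apply: (sorted_ltn_nth ltn_trans 0%N srt); rewrite ?inE // (leq_trans _ mi) // ltnW.
Qed.

(** [T] provides [m i - 1] slots of each colour [i], and index [j] takes the colour of the [j]-th
    slot. Then [m i] distinct indices of colour [i] would inject ['I_(m i)] into ['I_(m i - 1)]. *)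
Lemma sparse_coloring k (m : 'I_k -> nat) : (forall i, 0 < m i)%N ->
  exists col : nat -> option 'I_k,
    (forall j, (j < \sum_(i < k) (m i - 1))%N -> col j) /\
    forall i (J : nat -> nat),
      (forall j, (j < m i)%N ->
         (J j < \sum_(i < k) (m i - 1))%N /\ col (J j) = Some i) ->
      ~ (forall j l, (j < l)%N -> (l < m i)%N -> J j <> J l).
Proof.
move=> m0; pose T := {i : 'I_k & 'I_(m i - 1)}.
have cardT : (#|{: T}| = \sum_(i < k) (m i - 1))%N.
  by rewrite card_tagged sumnE big_map big_enum; apply: eq_bigr => i _; rewrite card_ord.
pose e (j : nat) : option T := omap enum_val (insub j : option 'I_#|{: T}|).
have eI j l : (j < #|{: T}|)%N -> (l < #|{: T}|)%N -> e j = e l -> j = l.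
  by move=> jT lT; rewrite /e !insubT /= => -[/enum_val_inj[]].
have eS j : (j < #|{: T}|)%N -> exists t, e j = Some t.
  by move=> jT; rewrite /e insubT /=; eexists.
exists (fun j => omap tag (e j)); rewrite -cardT; split=> [j /eS[t ->]//|i J JP].
apply: contraPnot (leqnn (m i)) => Jinj; apply/negP; rewrite -ltnNge.
have /choice[g gP] : forall j : 'I_(m i), exists l : 'I_(m i - 1),
    e (J j) = Some (Tagged (fun i => 'I_(m i - 1)) l).
  move=> j; have [/eS[[i' l] E]] := JP j (ltn_ord j).
  by rewrite E /= => -[E']; subst i'; exists l.
have ginj : injective g.
  move=> j l jl; apply/val_inj.
  have [jm _] := JP j (ltn_ord j); have [lm _] := JP l (ltn_ord l).
  have E : J j = J l by apply: eI => //; rewrite !gP jl.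
  case: (ltngtP j l) => // H; first by case: (Jinj _ _ H (ltn_ord _)).
  by case: (Jinj _ _ H (ltn_ord _)).
have := leq_card _ ginj; rewrite !card_ord => /leq_ltn_trans; apply.
by rewrite subn1 ltn_predL.
Qed.

(** [(w, x]] is open because [x] either has a successor in the segment, which bounds an open ray, or
    is the last point. In shifted coordinates [w = ozero] means no lower bound. *)
Lemma segment_nbhsP b (x : segment b) (U : set (segment b)) :
  nbhs x U <-> exists2 w, w < onat 1 +o val x &
    forall y : segment b, w < onat 1 +o val y -> y <= x -> U y.
Proof.
split.
  rewrite itv_nbhsE => -[[l r] [io xi] iU].
  have [w wx wP] : exists2 w, w < onat 1 +o val x &
      forall y : segment b, w < onat 1 +o val y -> (l <= BLeft y)%O.
    case: l io xi {iU} => [c l|c] io xi; last first.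
      rewrite (itv_open_ends_linfty io); exists ozero => //.
      exact: one_add_gt0.
    move: xi; rewrite (itv_open_ends_lside io) itv_boundlr => /andP[lx _].
    exists (onat 1 +o val l); first by rewrite oadd_lt2l; move: lx; rewrite bnd_simp.
    by move=> y; rewrite oadd_lt2l bnd_simp.
  exists w => // y wy yx; apply: iU; rewrite /= itv_boundlr wP //=.
  by move: xi; rewrite itv_boundlr => /andP[_]; apply: le_trans; rewrite bnd_simp.
move=> [w wx wU].
have [A nA AP] : exists2 A : set (segment b), nbhs x A &
    forall y, A y -> w < onat 1 +o val y.
  have [/eqP ->|] := boolP (w == ozero).
    by exists setT => [|y _]; [exact: filterT|exact: one_add_gt0].
  rewrite -ord_lt0x => /one_add_ex[v E]; rewrite E oadd_lt2l in wx *.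
  pose v' : segment b := exist _ v (lt_trans wx (valP x)).
  exists `]v', +oo[%classic.
    by apply: open_nbhs_nbhs; split; [exact: rray_open|rewrite /= in_itv /= andbT].
  by move=> y; rewrite /= in_itv /= andbT oadd_lt2l.
have [B nB BP] : exists2 B : set (segment b), nbhs x B & forall y, B y -> y <= x.
  have [sb|bs] := boolP (osucc (val x) < b).
    pose v' : segment b := exist _ (osucc (val x)) sb.
    exists `]-oo, v'[%classic.
      apply: open_nbhs_nbhs; split; first exact: lray_open.
      by rewrite /= in_itv /=; exact: osucc_gt.
    by move=> y; rewrite /= in_itv /= => H; rewrite leEsub -lt_osucc.
  exists setT => [|y _]; first exact: filterT.
  rewrite leEsub -lt_osucc; apply: lt_le_trans (valP y) _; by rewrite leNgt.
apply: filterS (filterI nA nB) => y [/AP Ay /BP By]; exact: wU.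
Qed.

Lemma homeomorphic_range b t (f : segment t -> segment b) :
    {homo f : x y / x < y} ->
    (forall x v, v < onat 1 +o val (f x) -> exists2 w, w < onat 1 +o val x &
       forall y : segment t, w < onat 1 +o val y -> y < x -> v < onat 1 +o val (f y)) ->
  homeomorphic (set_type (range f)) (segment t).
Proof.
move=> fmono fcont.
have finj x y : (f x < f y) = (x < y).
  case: (ltgtP x y) => [/fmono//|/fmono/ltW|->]; last by rewrite ltxx.
  by rewrite leNgt => /negbTE.
have /choice[g gP] : forall z : set_type (range f), exists x, f x = set_val z.
  by move=> z; have [x _ E] := set_valP z; exists x.
pose h x : set_type (range f) := SigSub (mem_set (imageT f x)).
exists g, h; split.
- move=> z U /segment_nbhsP[w wz wU].
  (* The inverse is continuous because an order embedding carries the lower bound [w''] of a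
     neighbourhood to the lower bound [f w'']. *)
  have [v vz vP] : exists2 v, v < onat 1 +o val (f (g z)) &
      forall y, v < onat 1 +o val (f y) -> w < onat 1 +o val y.
    have [/eqP ->|] := boolP (w == ozero).
      by exists ozero => [|y _]; exact: one_add_gt0.
    rewrite -ord_lt0x => /one_add_ex[w' E]; rewrite E oadd_lt2l in wz *.
    pose w'' : segment t := exist _ w' (lt_trans wz (valP (g z))).
    exists (onat 1 +o val (f w'')) => [|y]; rewrite oadd_lt2l -?ltEsub ?finj //.
    by rewrite oadd_lt2l.
  pose V := [set y : segment b | v < onat 1 +o val y /\ y <= set_val z].
  have nz : nbhs z (set_val @^-1` V).
    apply: (@initial_continuous _ _ (@set_val _ (range f)) z).
    by apply/segment_nbhsP; exists v; [rewrite -gP|].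
  change (nbhs z (g @^-1` U)); apply: filterS nz => y; rewrite /V /= => -[].
  rewrite -!gP => vy yz; apply: wU; first exact: vP.
  by move: yz; rewrite !leNgt finj.
- apply/continuous_comp_initial => x U /segment_nbhsP[v vx vU].
  have [w wx wP] := fcont _ _ vx; apply/segment_nbhsP; exists w => // y wy.
  rewrite le_eqVlt => /orP[/eqP ->|yx]; first exact: vU.
  by apply: vU; [exact: wP|rewrite ltW //= finj].
- by move=> z; apply: val_inj; exact: gP.
move=> x; apply/eqP; rewrite eq_le !leNgt -!finj gP ltxx //.
Qed.

(** The copy need not preserve order, but since [(v, f x]] is open, continuity still gives
    [f y <= f x] for all [y] just below [x]. *)
Lemma homeomorphic_embedding b t (X : set (segment b)) :
    homeomorphic (set_type X) (segment t) ->
  exists f : segment t -> segment b,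
    [/\ injective f, forall x, X (f x) &
        forall x v, v < onat 1 +o val (f x) -> exists2 w, w < onat 1 +o val x &
          forall y : segment t, w < onat 1 +o val y -> y <= x ->
            v < onat 1 +o val (f y) /\ f y <= f x].
Proof.
move=> [f [g [_ gc _ gK]]]; exists (set_val \o g); split.
- by apply: inj_comp (can_inj gK); exact: val_inj.
- by move=> x; exact: set_valP.
move=> x v vx.
have sc : continuous (set_val \o g : segment t -> segment b).
  move=> y; apply: continuous_comp; first exact: gc.
  exact: (@initial_continuous _ _ (@set_val _ X)).
pose V := [set y : segment b | v < onat 1 +o val y /\ y <= set_val (g x)].
have : nbhs x ((set_val \o g) @^-1` V).
  by apply: sc; apply/segment_nbhsP; exists v.
by move=> /segment_nbhsP[w wx H]; exists w.
Qed.

(** * The two bounds *)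

Lemma top_arrow_omega_bar k (a : 'I_k -> Ord) (m : 'I_k -> nat) M :
    (forall i, a i < omega1) -> (forall i, (0 < m i)%N) ->
    (\sum_(i < k) (m i - 1) < M)%N ->
  top_arrow (fun i => omega_bar (a i) (m i))
    (omega_bar (\big[natsum/ozero]_(i < k) a i) M).
Proof.
move=> a1 m0 ltM; set al := \big[_/_]_(_ < _) _ => c.
have M0 : (0 < M)%N by exact: leq_ltn_trans ltM.
set b := omega_bar al M in c *; set t := omega_pow al *o M.
have t1 : t < omega1 by apply/omul_omega1/omega_pow_omega1/big_natsum_omega1.
pose X i := [set y | exists2 x : segment b, y = onat 1 +o val x & c x = i].
have cov q : ozero < q -> q <= t -> exists i, X i q.
  move=> /one_add_ex[x ->]; rewrite -lt_omega_bar // => xb.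
  by exists (c (exist _ x xb)), (exist _ x xb).
have Xt i y : X i y -> y <= t.
  by move=> [x -> _]; rewrite -lt_omega_bar //; exact: (valP x).
(* [ir j] is a colour with a point of high rank for it in the block
   [(omega^al * j, omega^al * (j + 1)]]; for [j >= M] it is a placeholder. *)
have /choice[ir irP] : forall j, exists ir : 'I_k * Ord, (j < M)%N ->
    [/\ omega_pow al *o j < ir.2, ir.2 <= omega_pow al *o j.+1, X ir.1 ir.2 &
        cb_ge (X ir.1) (a ir.1) ir.2].
  move=> j; have [jM|_] := ltnP j M; last first.
    have [i _] : exists i, X i t.
      by apply: cov => //; rewrite -(omulx0 (omega_pow al)) omega_mul_lt.
    by exists (i, ozero).
  have jt : omega_pow al *o j.+1 <= t by apply: omul_mono; rewrite onat_le.
  have [i [q [? ? ? ?]]] := cb_ge_color cov (cb_ge_mul al (ltn0Sn j)) jt (omega_mul_ltS al j).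
  by exists (i, q).
have [i [J [J1 J2]]] := increasing_fibre (fun j => (ir j).1) ltM.
pose q j := if j is j'.+1 then (ir (J j')).2 else ozero.
have qP j : (j < m i)%N ->
    [/\ q j < q j.+1, q j.+1 < omega1, X i (q j.+1) & cb_ge (X i) (a i) (q j.+1)].
  move=> jm; have [JM Ji] := J1 _ jm; have [r1 r2 r3 r4] := irP _ JM.
  rewrite Ji in r3 r4; split=> //=; last exact: le_lt_trans (Xt _ _ r3) t1.
  case: j jm r1 {JM Ji r2 r3 r4} => [|j] jm r1 /=.
    by apply: le_lt_trans r1; exact: ozero_le.
  have [JM _] := J1 _ (ltnW jm); have [_ r2 _ _] := irP _ JM.
  apply: le_lt_trans r2 (le_lt_trans _ r1).
  by apply: omul_mono; rewrite onat_le; exact: J2.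
have [f [f1 f2 f3]] := cb_ge_normal_mul (a1 i) qP.
have /choice[h hP] : forall x : segment (omega_bar (a i) (m i)),
    exists y : segment b, f (onat 1 +o val x) = onat 1 +o val y /\ c y = i.
  move=> x; have := valP x; rewrite lt_omega_bar // => /f1.
  by move=> /(_ (one_add_gt0 _))[_ _ [y E cy]]; exists y.
exists i, (range h); split; first by move=> _ [x _ <-]; have [] := hP x.
have xt (x : segment (omega_bar (a i) (m i))) : onat 1 +o val x <= omega_pow (a i) *o m i.
  by rewrite -lt_omega_bar //; exact: (valP x).
apply: homeomorphic_range => [x y xy|x v].
  rewrite ltEsub -(oadd_lt2l (onat 1)); have [<- _] := hP x; have [<- _] := hP y.
  by apply: f2 => //; [exact: one_add_gt0|rewrite oadd_lt2l].
have [<- _] := hP x => /(f3 _ _ (one_add_gt0 _) (xt x))[w wx H].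
exists w => // y wy yx; have [<- _] := hP y; apply: H => //.
by rewrite oadd_lt2l.
Qed.

Lemma not_top_arrow k (a : 'I_k -> Ord) (m : 'I_k -> nat) b : (0 < k)%N ->
    (forall i, (0 < m i)%N) ->
    b < omega_bar (\big[natsum/ozero]_(i < k) a i) (\sum_(i < k) (m i - 1)).+1 ->
  ~ top_arrow (fun i => omega_bar (a i) (m i)) b.
Proof.
move=> k0 m0; set al := \big[_/_]_(_ < _) _; set M := (\sum_(_ < _) _)%N => bM.
have i0 : 'I_k by case: k k0 {a m m0 al M bM} => // k _; exact: ord0.
have [col [r [r1 r2]]] := ord_split_big_natsum a; rewrite -/al in r1 r2.
have [tcol [tcol1 tcol2]] := sparse_coloring m0.
(* For positive [y] of rank below [al], [rk y] is the exact rank: the least [d] such that no point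
   just below [y] has rank [d] or more. *)
have /choice[rk rkP] : forall y, exists d, ozero < y -> ~ cb_ge setT al y ->
    [/\ d < al, exists2 u, u < y & forall q, u < q -> q < y -> ~ cb_ge setT d q &
        forall e u, u < y -> (forall q, u < q -> q < y -> ~ cb_ge setT e q) -> d <= e].
  move=> y; have [y0|] := boolP (ozero < y); last by exists ozero.
  have [ry|/not_cb_ge[d [u [dal uy H]]]] := pselect (cb_ge setT al y).
    by exists ozero.
  have [|[v vy vH] L] := @oleastP [set d | exists2 u, u < y &
      forall q, u < q -> q < y -> ~ cb_ge setT d q].
    by exists d, u => // q uq qy; exact: H.
  exists (oleast [set d | exists2 u, u < y &
      forall q, u < q -> q < y -> ~ cb_ge setT d q]) => _ _; split.
  - by apply: le_lt_trans dal; apply: L; exists u => // q uq qy; exact: H.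
  - by exists v.
  by move=> e w wy wH; apply: L; exists w.
have rk_lt y : ozero < y -> ~ cb_ge setT al y -> exists2 u, u < y &
    forall q, u < q -> q < y -> ~ cb_ge setT al q /\ rk q < rk y.
  move=> y0 ny; have [dal [u uy uH] _] := rkP _ y0 ny; exists u => // q uq qy.
  have nq : ~ cb_ge setT al q by move=> /(cb_ge_le (ltW dal)); exact: uH.
  split=> //; have [e [v [ed vq H]]] := not_cb_ge (uH q uq qy).
  apply: le_lt_trans ed; have [_ _ L] := rkP _ (le_lt_trans (ozero_le _) uq) nq.
  by apply: (L _ v) => // z vz zq; exact: H.
have ixP y : exists j, forall i, y = omega_pow al *o i.+1 -> j = i.
  have [[i E]|H] := pselect (exists i, y = omega_pow al *o i.+1).
    exists i => j; rewrite E => /eqP; rewrite eq_le !leNgt !omega_mul_lt.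
    by case: ltngtP => // -[].
  by exists 0%N => i E; case: H; exists i.
have /choice[ix {}ixP] := ixP.
(* The default [i0] is never taken: points of rank at least [al] have an index below [M], where
   [tcol] is defined, and at other points [rk] is below [al], where [col] is. *)
pose c (x : segment b) := let y := onat 1 +o val x in
  odflt i0 (if `[< cb_ge setT al y >] then tcol (ix y) else col (rk y)).
move=> /(_ c)[i [X [Xc /homeomorphic_embedding[f [finj fX fcont]]]]].
have yM (x : segment b) : onat 1 +o val x < omega_pow al *o M.+1.
  exact: lt_lt_omega_bar bM (valP x).
(* Position of the rank inside piece [i]; points of rank at least [al] get [a i], which exceeds all
   those positions. *)
pose val_r y := if `[< cb_ge setT al y >] then a i else r (rk y).
have topE (x : segment b) : cb_ge setT al (onat 1 +o val x) ->
    exists2 j, (j < M)%N & onat 1 +o val x = omega_pow al *o j.+1.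
  move=> /(cb_ge_multiple (one_add_gt0 _) (yM x))[[|j] // jM ->].
  by exists j.
have small x : ~ cb_ge setT al (onat 1 +o val (f x)) ->
    col (rk (onat 1 +o val (f x))) = Some i /\ val_r (onat 1 +o val (f x)) < a i.
  move=> nx; have := Xc _ (fX x); rewrite /= /c /val_r asboolF //.
  have [dal _ _] := rkP _ (one_add_gt0 _) nx.
  by have [j -> rj] /= := r1 _ dal => <-.
(* Just below [x] the value at [f y] is strictly smaller: either [f x] is a multiple of [omega^al],
   with no other one nearby, or ranks drop near [f x] while staying in piece [i]. *)
have loc x : exists2 w, w < onat 1 +o val x &
    forall y, w < onat 1 +o val y -> y < x ->
      val_r (onat 1 +o val (f y)) < val_r (onat 1 +o val (f x)).
  have near v : v < onat 1 +o val (f x) -> exists2 w, w < onat 1 +o val x &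
      forall y, w < onat 1 +o val y -> y < x ->
        v < onat 1 +o val (f y) /\ onat 1 +o val (f y) < onat 1 +o val (f x).
    move=> /fcont[w wx H]; exists w => // y wy yx.
    have [vy yfx] := H y wy (ltW yx); split=> //; rewrite oadd_lt2l -ltEsub.
    by rewrite lt_neqAle yfx andbT; apply/eqP => /finj E; rewrite E ltxx in yx.
  have [rx|nx] := pselect (cb_ge setT al (onat 1 +o val (f x))).
    have [j jM E] := topE _ rx.
    have [|w wx H] := near (omega_pow al *o j); first by rewrite E omega_mul_ltS.
    exists w => // y wy yx; have [jy yj] := H y wy yx.
    have ny : ~ cb_ge setT al (onat 1 +o val (f y)).
      move=> /topE[l lM El]; move: jy yj; rewrite E El !omega_mul_lt !ltnS => jl.
      by rewrite ltnNge jl.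
    by rewrite {2}/val_r asboolT //; have [] := small _ ny.
  have [u uy uH] := rk_lt _ (one_add_gt0 _) nx.
  have [w wx H] := near _ uy; exists w => // y wy yx.
  have [uy' yx'] := H y wy yx; have [ny lt] := uH _ uy' yx'.
  have [cy _] := small _ ny; have [cx _] := small _ nx.
  rewrite /val_r !asboolF //; apply: r2 => //; last by rewrite cx cy.
  by have [] := rkP _ (one_add_gt0 _) nx.
(* An ordinal-valued function that drops strictly just below each point bounds the Cantor-Bendixson
   rank from above. *)
have rank_le d x : cb_ge setT d (onat 1 +o val x) -> d <= val_r (onat 1 +o val (f x)).
  elim/ord_ind: d x => d IH x /cb_geE H; apply: le_of_lt => e ed.
  have [w wx wP] := loc x; have [q [wq qx _ rq]] := H _ _ ed wx.
  have [z Eq] := one_add_ex (le_lt_trans (ozero_le _) wq); subst q.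
  rewrite oadd_lt2l in qx; pose z' : segment _ := exist _ z (lt_trans qx (valP x)).
  by apply: le_lt_trans (IH _ ed z' rq) _; exact: wP.
have /choice[x xP] : forall j, exists x : segment (omega_bar (a i) (m i)),
    (j < m i)%N -> onat 1 +o val x = omega_pow (a i) *o j.+1.
  have bar j : (j < m i)%N -> exists x : segment (omega_bar (a i) (m i)),
      onat 1 +o val x = omega_pow (a i) *o j.+1.
    move=> jm; have [|y E] := @one_add_ex (omega_pow (a i) *o j.+1).
      by rewrite -(omulx0 (omega_pow (a i))) omega_mul_lt.
    have yb : y < omega_bar (a i) (m i).
      by rewrite lt_omega_bar // -E; apply: omul_mono; rewrite onat_le.
    by exists (exist _ y yb).
  move=> j; have [/bar[y E]|_] := ltnP j (m i); first by exists y.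
  by have [y _] := bar _ (m0 i); exists y.
(* The [j]-th multiple point has rank at least [a i] in the copy, while the value at an image of
   rank below [al] would be less than [a i]. *)
have top j : (j < m i)%N -> cb_ge setT al (onat 1 +o val (f (x j))).
  move=> jm; apply: contrapT => /small[_]; apply/negP; rewrite -leNgt.
  by apply: rank_le; rewrite xP //; exact: cb_ge_mul.
apply: (tcol2 i (fun j => ix (onat 1 +o val (f (x j))))) => [j jm|j l jl lm].
  have [n nM E] := topE _ (top _ jm); rewrite (ixP _ _ E); split=> //.
  have := Xc _ (fX (x j)); rewrite /= /c asboolT ?(ixP _ _ E); last exact: top.
  by have := tcol1 _ nM; case: (tcol n) => //= ? _ ->.
have [n _ En] := topE _ (top _ (ltn_trans jl lm)).
have [p _ Ep] := topE _ (top _ lm).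
rewrite (ixP _ _ En) (ixP _ _ Ep) => np.
have /finj E : f (x j) = f (x l).
  by apply/val_inj/(@oaddI (onat 1)); rewrite En Ep np.
have := xP _ lm; rewrite -E xP ?(ltn_trans jl lm) // => /eqP.
by rewrite eq_le !leNgt !omega_mul_lt !ltnS jl ?andbF.
Qed.

Theorem theorem4p9 (k : nat) (a : 'I_k -> Ord) (m : 'I_k -> nat)
    (k_gt0 : (0 < k)%N)
    (a_lt : forall i, a i < omega1)
    (m_gt0 : forall i, (0 < m i)%N) :
  is_Ptop (fun i => omega_bar (a i) (m i))
    (omega_bar (\big[natsum/ozero]_(i < k) a i)
               (\sum_(i < k) (m i - 1) + 1)%N).
Proof.
split; first by apply: top_arrow_omega_bar => //; rewrite addn1.
move=> b bP; rewrite leNgt; apply/negP => ltb.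
by apply: (not_top_arrow k_gt0 m_gt0 _ bP); rewrite -addn1.
Qed.
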